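(* Let $H$ be a Hilbert space and let $Q\in\mathbb{B}(H)$ be an idempotent. Then $$Q=\big[P_{\mathcal{R}(Q)}\big(2m(Q)-I\big)P_{\mathcal{R}(Q)}\big]^\dag P_{\mathcal{R}(Q)}\big(2m(Q)-I\big)$$ and $$C^*\{Q\}=C^*\big\{m(Q),P_{\mathcal{R}(Q)}\big\}=C^*\big\{m(Q),I-P_{\mathcal{N}(Q)}\big\}.$$
   Context: $H$ is a non-zero complex Hilbert space, $\mathbb{B}(H)$ is the algebra of bounded linear operators on $H$, and $I$ is the identity. An idempotent is $Q\in\mathbb{B}(H)$ with $Q^2=Q$. $\mathcal{R}(T)$ and $\mathcal{N}(T)$ are the range and null space of $T$; for a closed subspace $M$ of $H$, $P_M$ is the orthogonal projection of $H$ onto $M$. For a subset $\mathfrak{F}\subseteq\mathbb{B}(H)$, $C^*\mathfrak{F}$ denotes the $C^*$-subalgebra of $\mathbb{B}(H)$ generated by $\mathfrak{F}$ (not assumed to contain $I$); in particular $C^*\{Q\}$ is the $C^*$-algebra generated by $Q$ alone. $|T|=(T^*T)^{1/2}$, and $T^\dag$ is the Moore-Penrose inverse of $T$ (when $T$ has closed range): the unique $X$ with $TXT=T$, $XTX=X$, $(TX)^*=TX$, $(XT)^*=XT$. The matched projection of an idempotent $Q$ is the projection $$m(Q)=\frac12\big(|Q^*|+Q^*\big)|Q^*|^\dag\big(|Q^*|+I\big)^{-1}\big(|Q^*|+Q\big).$$ *)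

(* Defs.v *)
From HB Require Import structures.
From mathcomp Require Import all_boot all_order all_algebra.
From mathcomp Require Import all_classical all_reals all_analysis.
From mathcomp Require Import complex.

Set Implicit Arguments.
Unset Strict Implicit.
Unset Printing Implicit Defensive.

Import Order.TTheory GRing.Theory Num.Theory.
Import numFieldNormedType.Exports.

Local Open Scope classical_set_scope.
Local Open Scope ring_scope.
Local Open Scope complex_scope.

(* Non-zero complex Hilbert spaces: the inner product is linear in its first
   argument, conjugate-linear in the second, and induces the norm. Requiring
   the space to be non-zero makes the bounded operators a non-trivial ring. *)
HB.mixin Record isHilbert (R : realType) H
    & CompleteNormedModule R[i] H := {
  inner : {dot H for @Num.conj R[i]} ;
  inner_norm : forall x : H, inner x x = `|x| ^+ 2 ;
  hilbert_nontrivial : exists x : H, x != 0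
}.

#[short(type="hilbertType")]
HB.structure Definition Hilbert (R : realType) :=
  {H of CompleteNormedModule R[i] H & isHilbert R H}.

Definition dotp (R : realType) (H : hilbertType R) (x y : H) : R[i] :=
  inner x y.

Notation "''[' x , y ]" := (dotp x y)
  (at level 0, format "''[' x ,  y ]") : ring_scope.

Section BoundedOperators.
Variables (R : realType) (H : hilbertType R).

Let rcD (a b : R) : (a + b)%:C = a%:C + b%:C. Proof. exact: rmorphD. Qed.
Let rcM (a b : R) : (a * b)%:C = a%:C * b%:C. Proof. exact: rmorphM. Qed.

Definition bounded_linear : {pred H -> H} :=
  [pred f : H -> H | `[< linear f /\ bounded_near f (nbhs (0 : H)) >]].

Record bop := BOp { bop_fun :> H -> H ; _ : bop_fun \in bounded_linear }.

HB.instance Definition _ := [isSub for bop_fun].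
HB.instance Definition _ := [Choice of bop by <:].

Lemma bounded_linearP (f : H -> H) :
  f \in bounded_linear <->
  linear f /\ exists M : R, forall x, `|f x| <= M%:C * `|x|.
Proof.
have lin (g : H -> H) (lg : linear g) : {h : {linear H -> H} | g = h}.
  pose m := GRing.isLinear.Build _ _ _ _ g lg.
  pose h : {linear H -> H} := HB.pack g m.
  by exists h.
rewrite unfold_in /=; split.
  move=> /asboolP [lf bf]; split=> //.
  have [h fh] := lin _ lf; rewrite {f lf}fh in bf *.
  have /pinfty_ex_gt0 [M M0 hM] := (linear_boundedP h).1 bf.
  exists (complex.Re M); suff -> : (complex.Re M)%:C = M by [].
  by apply/eqP; rewrite RRe_real // gtr0_real.
move=> [lf [M fM]]; apply/asboolP; split=> //.
have [h fh] := lin _ lf; rewrite {f lf}fh in fM *.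
apply/linear_boundedP; near=> r => x.
apply: le_trans (fM x) _; rewrite ler_wpM2r //.
near: r; apply: nbhs_pinfty_ge.
by apply/complex_realP; exists M.
Unshelve. all: by end_near. Qed.

Fact bounded_linear_submod_closed : submod_closed bounded_linear.
Proof.
split.
  apply/bounded_linearP; split; first by move=> a x y; rewrite /= scaler0 addr0.
  by exists 0 => x; rewrite normr0 mul0r.
move=> a f g /bounded_linearP [lf [M fM]] /bounded_linearP [lg [N gN]].
apply/bounded_linearP; split.
  move=> b x y; rewrite /= !fctE lf lg !scalerDr !scalerA (mulrC a b).
  by rewrite -!addrA; congr (_ + _); rewrite addrCA.
exists (complex.Re `|a| * M + N) => x; rewrite !fctE.
apply: le_trans (ler_normD _ _) _.
have aE : (complex.Re `|a|)%:C = `|a| by rewrite RRe_real // normr_real.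
by rewrite normrZ rcD rcM aE mulrDl -mulrA lerD // ler_wpM2l.
Qed.
HB.instance Definition _ :=
  GRing.isSubmodClosed.Build _ _ bounded_linear bounded_linear_submod_closed.
HB.instance Definition _ := [SubChoice_isSubLmodule of bop by <:].

Lemma bopP (S T : bop) : (forall x, S x = T x) -> S = T.
Proof. by move=> ST; apply/val_inj/funext. Qed.

Lemma bop_linear (T : bop) : linear T.
Proof. by case: T => f /= /bounded_linearP []. Qed.
HB.instance Definition _ (T : bop) :=
  GRing.isLinear.Build _ _ _ _ (bop_fun T) (bop_linear T).

Lemma bop_bounded (T : bop) : exists M : R, forall x, `|T x| <= M%:C * `|x|.
Proof. by case: T => f /= /bounded_linearP []. Qed.

Lemma bop0E x : (0 : bop) x = 0. Proof. by []. Qed.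
Lemma bopDE (S T : bop) x : (S + T) x = S x + T x. Proof. by []. Qed.
Lemma bopNE (T : bop) x : (- T) x = - T x. Proof. by []. Qed.
Lemma bopZE (a : R[i]) (T : bop) x : (a *: T) x = a *: T x. Proof. by []. Qed.

Fact bop_one_subproof : (@idfun H : H -> H) \in bounded_linear.
Proof.
by apply/bounded_linearP; split=> //; exists 1 => x; rewrite mul1r.
Qed.

Fact bop_mul_subproof (S T : bop) : S \o T \in bounded_linear.
Proof.
apply/bounded_linearP; split; first by move=> a x y; rewrite /= !linearP.
have [[M SM] [N TN]] := (bop_bounded S, bop_bounded T).
exists (`|M| * N) => x /=; apply: le_trans (SM _) _.
apply: (@le_trans _ _ (`|M|%:C * `|T x|)).
  by rewrite ler_wpM2r // lecR ler_norm.
by rewrite rcM -mulrA ler_wpM2l // lecR.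
Qed.

Definition bop_one := BOp bop_one_subproof.
Definition bop_mul (S T : bop) := BOp (bop_mul_subproof S T).

Fact bop_mulA : associative bop_mul. Proof. by move=> S T U; apply/bopP. Qed.
Fact bop_mul1 : left_id bop_one bop_mul. Proof. by move=> T; apply/bopP. Qed.
Fact bop_mulr1 : right_id bop_one bop_mul. Proof. by move=> T; apply/bopP. Qed.
Fact bop_mulDl : left_distributive bop_mul +%R.
Proof. by move=> S T U; apply/bopP. Qed.
Fact bop_mulDr : right_distributive bop_mul +%R.
Proof. by move=> S T U; apply/bopP => x; rewrite /= raddfD. Qed.
Fact bop_one_neq0 : bop_one != 0.
Proof.
have [x] := @hilbert_nontrivial R H; apply: contraNneq => e.
by rewrite -[x]/(bop_one x) e.
Qed.
HB.instance Definition _ := GRing.Zmodule_isNzRing.Build bop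
  bop_mulA bop_mul1 bop_mulr1 bop_mulDl bop_mulDr bop_one_neq0.

Lemma bop1E x : (1 : bop) x = x. Proof. by []. Qed.
Lemma bopME (S T : bop) x : (S * T) x = S (T x). Proof. by []. Qed.

Fact bop_scalerAl (a : R[i]) (S T : bop) : a *: (S * T) = a *: S * T.
Proof. by apply/bopP. Qed.
HB.instance Definition _ := GRing.Lmodule_isLalgebra.Build R[i] bop bop_scalerAl.
Fact bop_scalerAr (a : R[i]) (S T : bop) : a *: (S * T) = S * (a *: T).
Proof. by apply/bopP => x; rewrite bopME !bopZE linearZ. Qed.
HB.instance Definition _ := GRing.Lalgebra_isAlgebra.Build R[i] bop bop_scalerAr.

Definition bop_unit : pred bop :=
  [pred T | `[< exists S : bop, S * T = 1 /\ T * S = 1 >]].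
Definition bop_inv (T : bop) : bop := xget T [set S | S * T = 1 /\ T * S = 1].

Fact bop_mulVr : {in bop_unit, left_inverse 1 bop_inv *%R}.
Proof. by move=> T /asboolP /(xgetPex T) []. Qed.
Fact bop_divrr : {in bop_unit, right_inverse 1 bop_inv *%R}.
Proof. by move=> T /asboolP /(xgetPex T) []. Qed.
Fact bop_unitrP (T S : bop) : S * T = 1 /\ T * S = 1 -> bop_unit T.
Proof. by move=> ST; apply/asboolP; exists S. Qed.
Fact bop_invr_out : {in [predC bop_unit], bop_inv =1 id}.
Proof.
move=> T /asboolP nT; apply: xgetPN => S ST.
by apply: nT; exists S.
Qed.
HB.instance Definition _ := GRing.NzRing_hasMulInverse.Build bop
  bop_mulVr bop_divrr bop_unitrP bop_invr_out.

(* The norms of [H] and of operators take their values in [R[i]], where they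
   are real; [Re] extracts the real number whose supremum is taken. *)
Definition op_norm (T : bop) : R :=
  sup [set complex.Re `|T x| | x in [set x : H | `|x| <= 1]].

Let ReK (x : H) : (complex.Re `|x|)%:C = `|x|.
Proof. by rewrite RRe_real // normr_real. Qed.

Lemma op_norm_has_sup (T : bop) :
  has_sup [set complex.Re `|T x| | x in [set x : H | `|x| <= 1]].
Proof.
split; first by exists (complex.Re `|T 0|), 0 => //=; rewrite normr0.
have [M TM] := bop_bounded T; exists `|M| => _ [x /= x1 <-].
rewrite -lecR ReK; apply: le_trans (TM x) _.
apply: (@le_trans _ _ (`|M|%:C * `|x|)).
  by rewrite ler_wpM2r // lecR ler_norm.
by rewrite ler_piMr // ler0c.
Qed.

Lemma op_norm_ub (T : bop) x : `|x| <= 1 -> `|T x| <= (op_norm T)%:C.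
Proof.
move=> x1; rewrite -ReK lecR; apply: sup_upper_bound; last by exists x.
exact: op_norm_has_sup.
Qed.

Lemma op_norm_le (T : bop) (M : R) :
  (forall x, `|x| <= 1 -> `|T x| <= M%:C) -> op_norm T <= M.
Proof.
move=> TM; apply: ge_sup; first by case: (op_norm_has_sup T).
by move=> _ [x /= x1 <-]; rewrite -lecR ReK; apply: TM.
Qed.

Lemma op_normP (T : bop) x : `|T x| <= (op_norm T)%:C * `|x|.
Proof.
have [->|x0] := eqVneq x 0; first by rewrite raddf0 !normr0 mulr0.
have nx0 : 0 < `|x| by rewrite normr_gt0.
have := @op_norm_ub T (`|x|^-1 *: x).
rewrite linearZ /= !normrZ normfV normr_id mulVf ?gt_eqF // => /(_ (lexx _)).
by rewrite ler_pdivrMl // mulrC.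
Qed.

Fact op_normD (S T : bop) : (op_norm (S + T))%:C <= (op_norm S)%:C + (op_norm T)%:C.
Proof.
rewrite -rcD lecR; apply: op_norm_le => x x1.
by rewrite rcD; apply: le_trans (ler_normD _ _) _; rewrite lerD // op_norm_ub.
Qed.

Let op_normZ_le (a : R[i]) (T : bop) :
  (op_norm (a *: T))%:C <= `|a| * (op_norm T)%:C.
Proof.
have aE : `|a| = (complex.Re `|a|)%:C by rewrite RRe_real // normr_real.
rewrite aE -rcM lecR; apply: op_norm_le => x x1.
by rewrite bopZE normrZ rcM -aE ler_wpM2l // op_norm_ub.
Qed.

Fact op_normZ (a : R[i]) (T : bop) : (op_norm (a *: T))%:C = `|a| * (op_norm T)%:C.
Proof.
apply/eqP; rewrite eq_le op_normZ_le /=.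
have [->|a0] := eqVneq a 0.
  rewrite normr0 mul0r; apply: le_trans (normr_ge0 _) (@op_norm_ub _ 0 _).
  by rewrite normr0.
have := op_normZ_le a^-1 (a *: T).
by rewrite scalerA mulVf // scale1r normfV ler_pdivlMl ?normr_gt0.
Qed.

Fact op_norm_eq0 (T : bop) : (op_norm T)%:C = 0 -> T = 0.
Proof.
move=> T0; apply/bopP => x; apply/eqP; rewrite -normr_le0.
by apply: le_trans (op_normP T x) _; rewrite T0 mul0r.
Qed.

HB.instance Definition _ := Lmodule_isNormed.Build R[i] bop
  op_normD op_normZ op_norm_eq0.

End BoundedOperators.

Arguments bop {R} H.
Notation "''B' ( H )" := (bop H) (at level 8, format "''B' ( H )") : type_scope.

Section OperatorTheory.
Variables (R : realType) (H : hilbertType R).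
Implicit Types (S T X : 'B(H)) (A : set 'B(H)) (M : set H).

(* Objects characterized by a defining property are selected with [xget], which
   returns the (arbitrary) default 0 when no bounded operator has it. *)

Definition adj T : 'B(H) := xget 0 [set S : 'B(H) | forall x y, '[T x, y] = '[x, S y]].

Definition positive T := forall x, 0 <= '[T x, x].

Definition op_sqrt T : 'B(H) := xget 0 [set S : 'B(H) | positive S /\ S * S = T].

Definition op_abs T : 'B(H) := op_sqrt (adj T * T).

Definition moore_penrose T X :=
  [/\ T * X * T = T, X * T * X = X, adj (T * X) = T * X & adj (X * T) = X * T].

Definition mp_inv T : 'B(H) := xget 0 [set X : 'B(H) | moore_penrose T X].

Definition op_range T : set H := range T.

Definition op_null T : set H := [set x | T x = 0].

Definition orthogonal_projection M T :=
  forall x, M (T x) /\ forall y, M y -> '[x - T x, y] = 0.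

Definition oproj M : 'B(H) := xget 0 [set P : 'B(H) | orthogonal_projection M P].

Definition matched_projection T : 'B(H) :=
  2^-1 *: ((op_abs (adj T) + adj T) * mp_inv (op_abs (adj T))
           * (op_abs (adj T) + 1)^-1 * (op_abs (adj T) + T)).

(* C*-subalgebras of B(H), not required to contain the identity; [closed]
   refers to the topology of the operator norm. *)
Definition cstar_subalgebra A :=
  [/\ A 0,
      forall (a : R[i]) S T, A S -> A T -> A (a *: S + T),
      forall S T, A S -> A T -> A (S * T),
      forall T, A T -> A (adj T) &
      closed A].

Definition cstar_gen A : set 'B(H) := smallest cstar_subalgebra A.

End OperatorTheory.

(* Main.v *)
Require Import Defs.
From HB Require Import structures.
From mathcomp Require Import all_boot all_order all_algebra.
From mathcomp Require Import all_classical all_reals all_analysis.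
From mathcomp Require Import complex.
From mathcomp Require Import ring lra.

Set Implicit Arguments.
Unset Strict Implicit.
Unset Printing Implicit Defensive.

Import Order.TTheory GRing.Theory Num.Theory.
Import numFieldNormedType.Exports.

Local Open Scope classical_set_scope.
Local Open Scope ring_scope.

(* Write Q^* for the adjoint. The operator G = 1 + (Q - Q^* )^* (Q - Q^* ) =
   (Q + Q^* - 1)^2 is bounded below by 1, commutes with Q and Q^*, and satisfies
   G Q = Q Q^* Q. With J = G^(-1/2) every ingredient of m(Q) apart from
   (|Q^*| + 1)^-1 becomes a word in Q, Q^* and J: |Q^*| = Q Q^* J, its Moore-Penrose inverse is Q Q^* J^3,
   P_R(Q) = Q Q^* J^2 and 1 - P_N(Q) = Q^* Q J^2. Computing with these words, the
   operator U = 2 m(Q) - 1 satisfies U^2 = 1, P U P = |Q^*|^+, |Q^*| P U = Q and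
   U P U = 1 - P_N(Q) for P = P_R(Q); the formula for Q and the equality of the
   last two C^*-algebras follow.

   For the other C^*-algebra equality, the operators X such that X S lies in a
   given C^*-subalgebra for all S in it form a norm-closed unital algebra. It
   contains J and (|Q^*| + 1)^-1 because these belong to every norm-closed unital
   algebra containing G, respectively |Q^*| + 1. Conversely, in the case of
   C^*{m(Q), P} it contains |Q^*|^+ + 1 - P, hence also the inverse
   |Q^*| + 1 - P, which gives |Q^*| and then Q = |Q^*| P U. *)

(** * Real-valued norms and geometric convergence *)

Section RealNorm.
Context {R : realType}.
Local Open Scope complex_scope.
Implicit Types V : normedModType R[i].

Lemma realCD (a b : R) : (a + b)%:C = a%:C + b%:C. Proof. exact: rmorphD. Qed.
Lemma realCM (a b : R) : (a * b)%:C = a%:C * b%:C. Proof. exact: rmorphM. Qed.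

Definition rnorm V (x : V) : R := complex.Re `|x|.

Lemma rnormE V (x : V) : (rnorm x)%:C = `|x|.
Proof. by rewrite RRe_real // normr_real. Qed.

Lemma rnorm_ge0 V (x : V) : 0 <= rnorm x.
Proof. by rewrite -ler0c rnormE. Qed.

Lemma rnormD V (x y : V) : rnorm (x + y) <= rnorm x + rnorm y.
Proof. by rewrite -lecR realCD !rnormE ler_normD. Qed.

Lemma rnormB V (x y z : V) : rnorm (x - z) <= rnorm (x - y) + rnorm (y - z).
Proof. by rewrite -lecR realCD !rnormE ler_distD. Qed.

Lemma rnormN V (x : V) : rnorm (- x) = rnorm x.
Proof. by rewrite /rnorm normrN. Qed.

Lemma rnormZ V (a : R[i]) (x : V) : rnorm (a *: x) = complex.Re `|a| * rnorm x.
Proof.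
apply: (@complexI R).
by rewrite realCM !rnormE normrZ RRe_real // normr_real.
Qed.

Lemma rnormZC V (a : R) (x : V) : rnorm (a%:C *: x) = `|a| * rnorm x.
Proof. by rewrite rnormZ normc_def /= expr0n addr0 sqrtr_sqr. Qed.

Lemma rnorm0 V : rnorm (0 : V) = 0.
Proof. by rewrite /rnorm normr0. Qed.

Lemma rnorm_le0 V (x : V) : rnorm x <= 0 -> x = 0.
Proof. by rewrite -lecR rnormE normr_le0 => /eqP. Qed.

Lemma geometric_small (c q e : R) : 0 <= q < 1 -> 0 < e ->
  exists N, forall n, (N <= n)%N -> c * q ^+ n < e.
Proof.
move=> /andP[q0 q1] e0.
have : (geometric c q) n @[n --> \oo] --> (0 : R).
  by apply: cvg_geometric; rewrite ger0_norm.
move/cvgrPdist_lt => /(_ e e0) [N _ h]; exists N => n Nn.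
have := h n Nn; rewrite /= sub0r normrN; exact: le_lt_trans (ler_norm _).
Qed.

(** Stands in for passing to a limit: identities between limits are proved below by bounding the
    norm of a difference by [c * q ^+ n] for every [n]. *)
Lemma le0_geometric (a c q : R) :
  0 <= q < 1 -> (forall n, a <= c * q ^+ n) -> a <= 0.
Proof.
move=> q01 h; rewrite leNgt; apply/negP => a0.
have [N /(_ N (leqnn N))] := geometric_small c q01 a0.
by rewrite ltNge h.
Qed.

Lemma geometric_cvg (V : completeNormedModType R[i]) (u : nat -> V) (c q : R) :
  0 <= q < 1 -> (forall n, rnorm (u n.+1 - u n) <= c * q ^+ n) ->
  exists l, forall n, rnorm (u n - l) <= c / (1 - q) * q ^+ n.
Proof.
move=> q01 hu; have /andP[q0 q1] := q01.
have c0 : 0 <= c by have := hu 0%N; rewrite expr0 mulr1; apply: le_trans (rnorm_ge0 _).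
have q1' : 0 < 1 - q by rewrite subr_gt0.
set K := c / (1 - q); have K0 : 0 <= K by rewrite divr_ge0 // ltW.
have cE : c = K * (1 - q) by rewrite /K divfK // gt_eqF.
(* Writing [c] as [K * (1 - q)] makes the sum of the increments telescope. *)
have dist n k : rnorm (u n - u (n + k)%N) <= K * q ^+ n - K * q ^+ (n + k).
  elim: k => [|k ih]; first by rewrite addn0 subrr rnorm0 subrr.
  rewrite addnS; apply: le_trans (rnormB _ (u (n + k)%N) _) _.
  apply: le_trans (lerD ih _) _; first by rewrite -rnormN opprB; exact: hu.
  by rewrite cE exprS; lra.
have distm n m : (n <= m)%N -> rnorm (u n - u m) <= K * q ^+ n.
  move=> nm; rewrite -(subnKC nm); apply: le_trans (dist _ _) _.
  by rewrite gerBl mulr_ge0 // exprn_ge0.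
have cvgu : cvgn u.
  apply/cauchy_cvgP/cauchy_ballP => e e0.
  have eE : (complex.Re e)%:C = e by rewrite RRe_real // gtr0_real.
  have : 0 < complex.Re e by rewrite -ltcR eE.
  (* Two points of the tail from [N] on are each within [K * q ^+ N] of [u N], hence the factor
     2. *)
  move=> /(geometric_small (2 * K) q01)[N hN].
  pose B := u @` [set n | (N <= n)%N].
  exists (B, B); first by split; exists N => // n /= Nn; exists n.
  move=> [_ _] [/= [n /= Nn <-] [m /= Nm <-]]; rewrite -ball_normE /= -rnormE -eE ltcR.
  apply: le_lt_trans (hN N (leqnn N)).
  apply: le_trans (rnormB _ (u N) _) _.
  rewrite -rnormN opprB; apply: le_trans (lerD (distm _ _ Nn) (distm _ _ Nm)) _.
  by lra.
exists (limn u) => n; rewrite -subr_le0.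
rewrite leNgt; apply/negP => e0.
set e := _ - _ in e0.
have /cvgrPdist_lt/(_ e%:C) := cvgu.
rewrite ltcR => /(_ e0) [N _ hN].
have := hN (maxn N n) (leq_maxl _ _); rewrite /= -rnormE ltcR /e => h.
have := rnormB (u n) (u (maxn N n)) (limn u).
have := distm n _ (leq_maxr N n).
rewrite -rnormN opprB in h; lra.
Qed.

Lemma closed_approx V (A : set V) (x : V) : closed A ->
  (forall e : R, 0 < e -> exists y, A y /\ rnorm (y - x) <= e) -> A x.
Proof.
move=> cA h; apply: cA => B /nbhs_ballP[e /= e0 eB].
have eE : (complex.Re e)%:C = e by rewrite RRe_real // gtr0_real.
have e0' : 0 < complex.Re e / 2 by rewrite divr_gt0 // -ltcR eE.
have [y [Ay yx]] := h _ e0'; exists y; split=> //; apply: eB.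
rewrite -ball_normE /= -normrN opprB -rnormE -eE ltcR; apply: le_lt_trans yx _.
by move: e0'; lra.
Qed.

End RealNorm.

(** * Inner product identities, Cauchy-Schwarz and Riesz representation *)

Section InnerProduct.
Context {R : realType} {H : hilbertType R}.
Local Open Scope complex_scope.
Implicit Types (x y z : H) (a : R[i]).
Local Notation Re := complex.Re.

Lemma conjCE a : Num.conj a = conjc a.
Proof. by []. Qed.

Lemma dotC x y : '[x, y] = conjc '[y, x].
Proof. by rewrite /dotp hermC /= expr0 mul1r. Qed.

Lemma dotDl x y z : '[x + y, z] = '[x, z] + '[y, z].
Proof. exact: linearDl. Qed.

Lemma dotDr x y z : '[x, y + z] = '[x, y] + '[x, z].
Proof. exact: linearDr. Qed.

Lemma dotZl a x y : '[a *: x, y] = a * '[x, y].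
Proof. exact: linearZl_LR. Qed.

Lemma dotZr a x y : '[x, a *: y] = conjc a * '[x, y].
Proof. exact: linearZr_LR. Qed.

Lemma dotNl x y : '[- x, y] = - '[x, y].
Proof. exact: linearNl. Qed.

Lemma dotNr x y : '[x, - y] = - '[x, y].
Proof. exact: linearNr. Qed.

Lemma dotBl x y z : '[x - y, z] = '[x, z] - '[y, z].
Proof. by rewrite dotDl dotNl. Qed.

Lemma dotBr x y z : '[x, y - z] = '[x, y] - '[x, z].
Proof. by rewrite dotDr dotNr. Qed.

Lemma dot0l x : '[0, x] = 0.
Proof. exact: linear0l. Qed.

Lemma dot0r x : '[x, 0] = 0.
Proof. exact: linear0r. Qed.

Lemma dotxx x : '[x, x] = (rnorm x ^+ 2)%:C.
Proof. by rewrite /dotp inner_norm -rnormE rmorphXn. Qed.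

Lemma Re_conj a : Re (conjc a) = Re a.
Proof. by case: a. Qed.

Lemma Re_realM (t : R) a : Re (t%:C * a) = t * Re a.
Proof. by case: a => u v /=; rewrite mul0r subr0. Qed.

Lemma dot_injl x y : (forall z, '[x, z] = '[y, z]) -> x = y.
Proof.
move=> h; apply/subr0_eq/rnorm_le0.
have : '[x - y, x - y] = 0 by rewrite dotBl h subrr.
by rewrite dotxx => /complexI/eqP; rewrite sqrf_eq0 => /eqP->.
Qed.

Lemma dot_injr x y : (forall z, '[z, x] = '[z, y]) -> x = y.
Proof. by move=> h; apply: dot_injl => z; rewrite dotC h -dotC. Qed.


Lemma rnorm2E x : rnorm x ^+ 2 = Re '[x, x].
Proof. by rewrite dotxx. Qed.

Lemma Re_dotC x y : Re '[x, y] = Re '[y, x].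
Proof. by rewrite dotC Re_conj. Qed.

Lemma rnormBZ x y (t : R) :
  rnorm (x - t%:C *: y) ^+ 2 =
  rnorm x ^+ 2 - 2 * t * Re '[x, y] + t ^+ 2 * rnorm y ^+ 2.
Proof.
have tE : conjc t%:C = t%:C :> R[i] by rewrite /conjc /= oppr0.
rewrite !rnorm2E !(dotBl, dotBr, dotZl, dotZr) tE !raddfB /= !Re_realM.
by rewrite (Re_dotC y x); ring.
Qed.

Lemma parallelogram x y :
  rnorm (x + y) ^+ 2 + rnorm (x - y) ^+ 2 = 2 * rnorm x ^+ 2 + 2 * rnorm y ^+ 2.
Proof.
by rewrite !rnorm2E !(dotBl, dotBr, dotDl, dotDr) !raddfB !raddfD /= raddfN /=; ring.
Qed.

(** [z] is [x] without its component along [y], so this is Pythagoras. Nonnegativity of the left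
    side gives Cauchy-Schwarz; the formula also drives the orthogonality step of [riesz]. *)
Lemma dot_residue x y (z := x - ('[x, y] / '[y, y]) *: y) : y != 0 ->
  '[z, z] = '[x, x] - `|'[x, y]| ^+ 2 / '[y, y].
Proof.
move=> y0; have yy0 : '[y, y] != 0.
  apply: contraNneq y0; rewrite dotxx => /complexI/eqP.
  by rewrite sqrf_eq0 => /eqP y0; apply/eqP/rnorm_le0; rewrite y0.
have zy : '[z, y] = 0 by rewrite dotBl dotZl divfK // subrr.
rewrite {2}/z dotBr dotZr zy mulr0 subr0 dotBl dotZl normCK (dotC y x).
by rewrite conjCE mulrAC.
Qed.

Lemma cauchy_schwarz x y : `|'[x, y]| <= `|x| * `|y|.
Proof.
have [->|y0] := eqVneq y 0; first by rewrite dot0r !normr0 mulr0.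
rewrite -(@ler_pXn2r _ 2) ?nnegrE ?mulr_ge0 // exprMn.
have yy : '[y, y] = `|y| ^+ 2 by rewrite dotxx rmorphXn /= rnormE.
have xx : '[x, x] = `|x| ^+ 2 by rewrite dotxx rmorphXn /= rnormE.
rewrite -ler_pdivrMr ?exprn_gt0 ?normr_gt0 // -yy -xx -subr_ge0.
by rewrite -dot_residue // dotxx ler0c sqr_ge0.
Qed.

(* The representing vector is a multiple of the element of least norm in the
   affine hyperplane [f = 1]. *)
Lemma riesz (f : H -> R[i]) (M : R) : linear_for *%R f ->
  (forall x, `|f x| <= M%:C * `|x|) -> exists z, forall x, f x = '[x, z].
Proof.
move=> lf bf.
have fZ a x : f (a *: x) = a * f x.
  (* The instance at [-1], [0], [0] gives [f 0 = 0]. *)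
  have := lf a x 0; have := lf (-1) 0 0.
  by rewrite scaler0 addr0 mulN1r addNr !addr0 => ->; rewrite addr0.
have fD x y : f (x + y) = f x + f y by have := lf 1 x y; rewrite scale1r mul1r.
have fN x : f (- x) = - f x by rewrite -scaleN1r fZ mulN1r.
have fB x y : f (x - y) = f x - f y by rewrite fD fN.
have [f0|] := pselect (forall x, f x = 0); first by exists 0 => x; rewrite f0 dot0r.
move=> /existsNP[x0 /eqP fx0].
pose S := [set rnorm x ^+ 2 | x in [set x | f x = 1]].
have infS : has_inf S.
  split; last by exists 0 => _ [x _ <-]; exact: sqr_ge0.
  by exists (rnorm ((f x0)^-1 *: x0) ^+ 2), ((f x0)^-1 *: x0) => //=; rewrite fZ mulVf.
set D := inf S.
have Dle x : f x = 1 -> D <= rnorm x ^+ 2.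
  by move=> fx; apply: ge_inf; [case: infS | exists x].
have D0 : 0 <= D by apply: lb_le_inf; [case: infS | move=> _ [x _ <-]; exact: sqr_ge0].
(* A minimizing sequence. Midpoints of its terms stay in the hyperplane, so the parallelogram law
   bounds the squared successive distances by [5 / 2] times the square of [(1 / 2) ^+ n], which is
   below the square of [2 * (1 / 2) ^+ n]. *)
have /choice[u hu] : forall n : nat, exists x, f x = 1 /\ rnorm x ^+ 2 <= D + ((1 / 2) ^+ n) ^+ 2.
  move=> n; have p : 0 < ((1 / 2 : R) ^+ n) ^+ 2 by rewrite !exprn_gt0.
  have [_ [x fx <-] h] := inf_adherent p infS.
  by exists x; split=> //; exact: ltW.
have q01 : 0 <= (1 / 2 : R) < 1 by apply/andP; split; lra.
have qn n : 0 <= (1 / 2 : R) ^+ n <= 1.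
  by rewrite exprn_ge0 ?exprn_ile1 //; lra.
have [|l hl] := @geometric_cvg _ H u 2 _ q01.
  move=> n; rewrite -(@ler_pXn2r _ 2) ?nnegrE ?rnorm_ge0 //.
  have [[fn hn] [fm hm]] := (hu n, hu n.+1).
  have fmid : f ((2^-1 : R)%:C *: (u n.+1 + u n)) = 1.
    rewrite fZ fD fn fm -(rmorph1 (real_complex R)) -rmorphD -rmorphM /=.
    by congr (_%:C); field.
  have := Dle _ fmid; rewrite rnormZC.
  rewrite exprMn ger0_norm ?invr_ge0 // => h.
  have := parallelogram (u n.+1) (u n).
  move: hm; rewrite (exprS (1 / 2)); have := qn n; have : (2^-1 : R) ^+ 2 = 1 / 4 by field.
  move: h => /[swap] ->.
  move: hn; set q := _ ^+ n => hn h _ hm par.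
  have := sqr_ge0 q; lra.
have fl : f l = 1.
  apply/eqP; rewrite -subr_eq0 -normr_le0 -(rnormE (V := R[i]^o)) lecR.
  apply: (le0_geometric q01 (c := `|M| * (2 / (1 - 1 / 2)))) => n.
  have -> : f l - 1 = f (l - u n) by rewrite fB (hu n).1.
  apply: (@le_trans _ _ (`|M| * rnorm (l - u n))).
    rewrite -lecR realCM (rnormE (V := R[i]^o)) rnormE.
    by apply: le_trans (bf _) _; rewrite ler_wpM2r // lecR ler_norm.
  rewrite -mulrA ler_wpM2l //; rewrite -rnormN opprB; exact: hl.
have normD x y : rnorm x <= rnorm y + rnorm (y - x).
  by rewrite -(rnormN (y - x)) opprB -{1}(subrKC y x) rnormD.
have lmin : rnorm l ^+ 2 <= D.
  set K := 2 / (1 - 1 / 2) in hl.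
  (* With [q = (1 / 2) ^+ n], expand the square of [rnorm (u n) + K * q]: the first term is at most
     [D + q], the cross term at most [2 * (D + 1) * K * q] because [rnorm (u n) <= D + 1], and the
     last at most [K ^+ 2 * q]. *)
  rewrite -subr_le0; apply: (le0_geometric q01 (c := 1 + 2 * (D + 1) * K + K ^+ 2)) => n.
  have [_ hn] := hu n; have := hl n; have := qn n; have := normD l (u n).
  set q := (_ ^+ n) in hn *.
  set a := rnorm l; set b := rnorm (u n) in hn *; set d := rnorm _ => h1 /andP[q0 q1] h2.
  have b0 : 0 <= b := rnorm_ge0 _; have d0 : 0 <= d := rnorm_ge0 _.
  have a0 : 0 <= a := rnorm_ge0 _.
  have K0 : 0 <= K by rewrite /K divr_ge0 //; lra.
  have qq : q ^+ 2 <= q by rewrite expr2; nra.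
  have bD : b <= D + 1 by nra.
  have Kq : 0 <= K * q by rewrite mulr_ge0.
  have abq : a <= b + K * q by lra.
  have aa : a ^+ 2 <= (b + K * q) ^+ 2 by rewrite ler_pXn2r ?nnegrE ?addr_ge0.
  have bK : b * (K * q) <= (D + 1) * (K * q) by exact: ler_wpM2r.
  have KK : K ^+ 2 * q ^+ 2 <= K ^+ 2 * q by apply: ler_wpM2l; rewrite ?sqr_ge0.
  rewrite sqrrD exprMn in aa; lra.
(* Removing from [l] its component along [w] keeps [f l = 1] and lowers the squared norm unless
   ['[l, w]] vanishes. *)
have orth w : f w = 0 -> '[l, w] = 0.
  move=> fw; have [->|w0] := eqVneq w 0; first by rewrite dot0r.
  have := dot_residue l w0; set a := '[l, w] / _; set z := l - _ => zz.
  have fz : f z = 1 by rewrite fB fZ fw mulr0 subr0.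
  have := le_trans lmin (Dle _ fz); rewrite -lecR -!dotxx {}zz.
  rewrite lerBrDl gerDr => h.
  have ww : 0 < '[w, w].
    rewrite dotxx ltcR exprn_gt0 // lt_def rnorm_ge0 andbT.
    by apply: contraNneq w0 => w0; apply/eqP/rnorm_le0; rewrite w0.
  move: h; rewrite ler_pdivrMr // mul0r => h.
  by apply/eqP; rewrite -normr_eq0 -sqrf_eq0 eq_le h exprn_ge0.
have ll : '[l, l] != 0.
  apply/eqP; rewrite dotxx => /complexI/eqP; rewrite sqrf_eq0 => /eqP l0.
  have {}l0 : l = 0 by apply: rnorm_le0; rewrite l0.
  by have := fB 0 0; rewrite !subrr -{1}l0 fl => /eqP; rewrite oner_eq0.
(* [x - f x *: l] is in the kernel of [f], hence orthogonal to [l], so ['[x, l] = f x * '[l, l]].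
   The conjugate undoes conjugate-linearity in the second argument. *)
exists (conjc '[l, l]^-1 *: l) => x; rewrite dotZr conjcK mulrC.
have : '[x - f x *: l, l] = 0.
  by rewrite dotC orth ?conjc0 // fB fZ fl mulr1 subrr.
by rewrite dotBl dotZl => /subr0_eq ->; rewrite mulfK.
Qed.

End InnerProduct.

(** * Operator norm estimates and adjoints *)

Section Adjoint.
Context {R : realType} {H : hilbertType R}.
Local Open Scope complex_scope.
Implicit Types (x y z : H) (a : R[i]) (S T X : 'B(H)).
Local Notation Re := complex.Re.

Lemma bop_realP T x : rnorm (T x) <= op_norm T * rnorm x.
Proof. by rewrite -lecR realCM !rnormE op_normP. Qed.

Lemma op_norm_ge0 T : 0 <= op_norm T.
Proof. exact: (@rnorm_ge0 _ 'B(H)). Qed.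

Lemma op_norm_bound T (M : R) : 0 <= M ->
  (forall x, rnorm (T x) <= M * rnorm x) -> op_norm T <= M.
Proof.
move=> M0 h; apply: op_norm_le => x x1; rewrite -rnormE lecR.
apply: le_trans (h x) _; rewrite ler_piMr // -lecR rnormE.
exact: x1.
Qed.

Lemma bop_exists (f : H -> H) (M : R) : linear f ->
  (forall x, rnorm (f x) <= M * rnorm x) -> exists T : 'B(H), T =1 f.
Proof.
move=> lf bf; have bl : f \in bounded_linear (H := H).
  apply/bounded_linearP; split=> //; exists M => x.
  by rewrite -!rnormE -realCM lecR.
by exists (BOp bl).
Qed.

(** Cauchy-Schwarz for [T (f y)] and [y] bounds [rnorm (f y) ^+ 2], and one factor cancels. As [f]
    is a bare function, the bound can serve in constructing the adjoint. *)
Lemma adjoint_bound T (f : H -> H) : (forall x y, '[T x, y] = '[x, f y]) ->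
  forall y, rnorm (f y) <= op_norm T * rnorm y.
Proof.
move=> Tf y.
have := cauchy_schwarz (T (f y)) y; rewrite Tf dotxx -!rnormE.
rewrite ger0_norm ?ler0c ?sqr_ge0 // -realCM lecR => h.
have := bop_realP T (f y); have := op_norm_ge0 T.
have := rnorm_ge0 (f y); have := rnorm_ge0 y.
set a := rnorm y in h *; set b := rnorm (f y) in h *; set c := rnorm _ in h *.
set M := op_norm T => a0 b0 M0 cb.
have [-> //|bn] := eqVneq b 0; first by rewrite mulr_ge0.
have {bn}b0 : 0 < b by rewrite lt_def bn.
rewrite -(ler_pM2r b0) -expr2; apply: le_trans h _.
by rewrite mulrAC; apply: ler_wpM2r.
Qed.

(** Riesz representation of [x |-> '[T x, y]] for each [y]. It excludes the default 0 in [adj], so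
    [adjP] holds for every [T]. *)
Lemma adjoint_exists T : exists S : 'B(H), forall x y, '[T x, y] = '[x, S y].
Proof.
have /choice[f hf] : forall y, exists z, forall x, '[T x, y] = '[x, z].
  move=> y; apply: (@riesz _ _ _ (op_norm T * rnorm y)) => [a u v|x].
    by rewrite linearP dotDl dotZl.
  apply: le_trans (cauchy_schwarz _ _) _; rewrite -!rnormE -!realCM lecR.
  by rewrite mulrAC; apply: ler_wpM2r; rewrite ?rnorm_ge0 ?bop_realP.
have lf : linear f.
  move=> a u v; apply: dot_injr => z.
  by rewrite -hf !(dotDr, dotZr) -!hf.
have [S SE] : exists S : 'B(H), S =1 f.
  apply: (@bop_exists _ (op_norm T)) => // y; exact: adjoint_bound.
by exists S => x y; rewrite SE.
Qed.

Lemma adjP T x y : '[T x, y] = '[x, adj T y].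
Proof.
exact: (xgetPex 0 (adjoint_exists T)).
Qed.

Lemma adjPr T x y : '[x, T y] = '[adj T x, y].
Proof. by rewrite dotC adjP -dotC. Qed.

Lemma adj_unique T S : (forall x y, '[T x, y] = '[x, S y]) -> adj T = S.
Proof. by move=> h; apply/bopP => y; apply: dot_injr => x; rewrite -adjP. Qed.

Lemma adjK T : adj (adj T) = T.
Proof. by apply: adj_unique => x y; rewrite -adjPr. Qed.

Lemma adjM S T : adj (S * T) = adj T * adj S.
Proof. by apply: adj_unique => x y; rewrite !bopME !adjP. Qed.

Lemma adjD S T : adj (S + T) = adj S + adj T.
Proof. by apply: adj_unique => x y; rewrite !bopDE dotDl dotDr !adjP. Qed.

Lemma adjZ a T : adj (a *: T) = conjc a *: adj T.
Proof. by apply: adj_unique => x y; rewrite !bopZE dotZl dotZr adjP conjcK. Qed.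

Lemma adjN T : adj (- T) = - adj T.
Proof. by apply: adj_unique => x y; rewrite !bopNE dotNl dotNr adjP. Qed.

Lemma adjB S T : adj (S - T) = adj S - adj T.
Proof. by rewrite adjD adjN. Qed.

Lemma adj_one : adj (1 : 'B(H)) = 1.
Proof. exact: adj_unique. Qed.

Lemma op_normM S T : op_norm (S * T) <= op_norm S * op_norm T.
Proof.
apply: op_norm_bound => [|x]; first by rewrite mulr_ge0 ?op_norm_ge0.
rewrite bopME -mulrA; apply: le_trans (bop_realP _ _) _.
by apply: ler_wpM2l; rewrite ?op_norm_ge0 ?bop_realP.
Qed.

Lemma op_norm_adj T : op_norm (adj T) = op_norm T.
Proof.
have le S : op_norm (adj S) <= op_norm S.
  apply: op_norm_bound; first exact: op_norm_ge0.
  by apply: adjoint_bound; exact: adjP.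
by apply/eqP; rewrite eq_le le -{1}(adjK T) le.
Qed.

(** Polarization: the defect [b] vanishes on the diagonal, hence is antisymmetric; replacing [y] by
    ['i *: y] shows that it is also symmetric, so it is zero. *)
Lemma positive_adj T : positive T -> adj T = T.
Proof.
move=> Tp; apply: adj_unique => x y.
pose b u v := '[T u, v] - '[u, T v].
have b0 u : b u u = 0.
  rewrite /b [X in _ - X]dotC; have := Tp u.
  by move/ger0_real/CrealP; rewrite conjCE => ->; rewrite subrr.
have bD u v : b u v + b v u = 0.
  rewrite -(b0 (u + v)) /b !raddfD /= !(dotDl, dotDr) -/(b u u).
  have := b0 u; have := b0 v; rewrite /b => h1 h2.
  have -> : '[T u, u] = '[u, T u] by apply/subr0_eq.
  have -> : '[T v, v] = '[v, T v] by apply/subr0_eq.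
  ring.
apply/subr0_eq; rewrite -/(b x y).
have := bD x ('i%C *: y); have := bD x y.
have -> : b x ('i%C *: y) = - 'i%C * b x y.
  rewrite /b linearZ /= !dotZr mulrBr.
  suff -> : conjc 'i%C = - 'i%C :> R[i] by [].
  by apply/eqP; rewrite eq_complex /= oppr0 !eqxx.
have -> : b ('i%C *: y) x = 'i%C * b y x by rewrite /b linearZ /= !dotZl mulrBr.
move=> h /eqP; rewrite addrC mulNr -mulrBr mulf_eq0 => /orP[|/eqP/subr0_eq e].
  by rewrite eq_complex /= oner_eq0 andbF.
by move: h; rewrite e => /eqP; rewrite -mulr2n mulrn_eq0 => /eqP.
Qed.

End Adjoint.

(** * Inverses and square roots inside closed algebras, by contraction *)

Section OperatorAlgebra.
Context {R : realType} {H : hilbertType R}.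
Local Open Scope complex_scope.
Implicit Types (x y z : H) (a : R[i]) (S T X Y Z : 'B(H)) (M A : set 'B(H)).
Local Notation Re := complex.Re.

Lemma op_normD_le S T : op_norm (S + T) <= op_norm S + op_norm T.
Proof. exact: (@rnormD _ 'B(H)). Qed.

Lemma op_normB_le S T X : op_norm (S - X) <= op_norm (S - T) + op_norm (T - X).
Proof. exact: (@rnormB _ 'B(H)). Qed.

Lemma op_normN T : op_norm (- T) = op_norm T.
Proof. exact: (@rnormN _ 'B(H)). Qed.

Lemma op_normZC (t : R) T : op_norm (t%:C *: T) = `|t| * op_norm T.
Proof. exact: (@rnormZC _ 'B(H)). Qed.

Lemma op_norm_le0 T : op_norm T <= 0 -> T = 0.
Proof. exact: (@rnorm_le0 _ 'B(H)). Qed.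

(** The limit is taken pointwise in [H]; the uniform geometric rate makes it linear and bounded and
    gives convergence in operator norm. *)
Lemma bop_geometric_cvg (u : nat -> 'B(H)) (c q : R) : 0 <= q < 1 ->
  (forall n, op_norm (u n.+1 - u n) <= c * q ^+ n) ->
  exists L, forall n, op_norm (u n - L) <= c / (1 - q) * q ^+ n.
Proof.
move=> q01 hu; have /andP[q0 q1] := q01.
have c0 : 0 <= c by have := hu 0%N; rewrite expr0 mulr1; apply: le_trans (op_norm_ge0 _).
have K0 : 0 <= c / (1 - q) by rewrite divr_ge0 // subr_ge0 ltW.
have /choice[f hf] : forall x, exists l, forall n,
    rnorm (u n x - l) <= c / (1 - q) * rnorm x * q ^+ n.
  move=> x; have [|l hl] := @geometric_cvg _ H (fun n => u n x) (c * rnorm x) q q01.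
    move=> n; rewrite mulrAC; apply: le_trans (bop_realP (u n.+1 - u n) x) _.
    by apply: ler_wpM2r; rewrite ?rnorm_ge0.
  by exists l => n; rewrite [_ / _ * _]mulrAC; exact: hl.
set K := c / (1 - q) in hf *.
have lf : linear f.
  move=> a x y; apply/subr0_eq/rnorm_le0.
  pose d := Re `|a| * (K * rnorm x) + K * rnorm y + K * rnorm (a *: x + y).
  apply: (le0_geometric q01 (c := d)) => n.
  have -> : f (a *: x + y) - (a *: f x + f y) =
      a *: (u n x - f x) + (u n y - f y) - (u n (a *: x + y) - f (a *: x + y)).
    rewrite (bop_linear (u n)) scalerBr [_ - _ + (_ - _)]addrACA -opprD opprB [RHS]addrC.
    by rewrite subrKA.
  rewrite /d 2!mulrDl; apply: le_trans (rnormD _ _) _; rewrite rnormN.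
  apply: lerD; last exact: hf.
  apply: le_trans (rnormD _ _) _; apply: lerD; last exact: hf.
  rewrite rnormZ -mulrA; apply: ler_wpM2l; last exact: hf.
  exact: (@rnorm_ge0 _ R[i]^o).
have [|L LE] := @bop_exists _ H f (op_norm (u 0%N) + K) lf.
  move=> x; rewrite mulrDl; have := hf x 0%N; rewrite expr0 mulr1 => h.
  rewrite -(subKr (u 0%N x) (f x)); apply: le_trans (rnormD _ _) _.
  by rewrite rnormN lerD // bop_realP.
exists L => n; apply: op_norm_bound => [|x]; first by rewrite mulr_ge0 // exprn_ge0.
by rewrite bopDE bopNE LE mulrAC.
Qed.

Definition limit_closed M := forall T,
  (forall e : R, 0 < e -> exists S, M S /\ op_norm (S - T) <= e) -> M T.

(** Banach's fixed point theorem, recording that the fixed point stays in [M]. This replaces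
    functional calculus in showing that inverses and square roots lie in a given algebra. *)
Lemma contraction_fixpoint M (F : 'B(H) -> 'B(H)) Z0 (q : R) :
  0 <= q < 1 -> limit_closed M -> M Z0 -> (forall Z, M Z -> M (F Z)) ->
  (forall Y Z, M Y -> M Z -> op_norm (F Y - F Z) <= q * op_norm (Y - Z)) ->
  exists2 Z, M Z & F Z = Z.
Proof.
move=> q01 clM M0 MF cF; have /andP[q0 q1] := q01.
pose u n := iter n F Z0.
have Mu n : M (u n) by elim: n => //= n; exact: MF.
have [|L hL] := @bop_geometric_cvg u (op_norm (u 1%N - u 0%N)) q q01.
  elim=> [|n ih]; first by rewrite expr0 mulr1.
  rewrite exprS mulrCA; apply: le_trans (ler_wpM2l q0 ih).
  exact: (cF (u n.+1) (u n)).
set K := _ / _ in hL.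
have ML : M L.
  apply: clM => e e0; have [N hN] := geometric_small K q01 e0.
  by exists (u N); split=> //; apply: le_trans (hL N) (ltW (hN N _)).
exists L => //; apply/subr0_eq/op_norm_le0.
apply: (le0_geometric q01 (c := 2 * (K * q))) => n.
apply: le_trans (op_normB_le _ (u n.+1) _) _.
have h1 := cF _ _ ML (Mu n); have h2 := hL n.+1; have := hL n.
rewrite -op_normN opprB => h3; rewrite exprS in h2.
have h4 := ler_wpM2l q0 h3.
rewrite -/(u n.+1) /= in h1 *; lra.
Qed.

(** Closure under [adj] is left out because commutants and left multipliers, the instances used
    below, lack it in general. *)
Definition closed_unital_algebra M :=
  [/\ M 1, forall a S T, M S -> M T -> M (a *: S + T),
      forall S T, M S -> M T -> M (S * T) & limit_closed M].

(** Expanding the square of [rnorm (x - t *: X x)] gives at most [1 - 2 * t * c + t ^+ 2 * m ^+ 2]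
    times [rnorm x ^+ 2]; the choice [t = c / m ^+ 2] turns this factor into [1 - t * c]. *)
Lemma accretive_contraction X (c : R) : 0 < c ->
  (forall x, c * rnorm x ^+ 2 <= Re '[X x, x]) ->
  exists t q : R, [/\ 0 < t, 0 <= q < 1 & op_norm (1 - t%:C *: X) <= q].
Proof.
move=> c0 Xc.
(* The maximum with [c] ensures [0 < m] and [t * c <= 1]. *)
pose m := Num.max (op_norm X) c.
have mX : op_norm X <= m by rewrite le_max lexx.
have mc : c <= m by rewrite le_max lexx orbT.
have m0 : 0 < m by apply: lt_le_trans mc.
have m20 : 0 < m ^+ 2 by rewrite exprn_gt0.
pose t := c / m ^+ 2.
have t0 : 0 < t by rewrite divr_gt0.
have tm : t * m ^+ 2 = c by rewrite divfK // gt_eqF.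
have tc : t * c <= 1.
  rewrite /t mulrAC ler_pdivrMr // mul1r -expr2 ler_pXn2r ?nnegrE //; exact: ltW.
have tc0 : 0 < t * c by rewrite mulr_gt0.
have q20 : 0 <= 1 - t * c by rewrite subr_ge0.
exists t, (Num.sqrt (1 - t * c)); split=> //.
  by rewrite sqrtr_ge0 /= -[ltRHS]sqrtr1 ltr_sqrt // gtrBl.
apply: op_norm_bound => [|x]; first exact: sqrtr_ge0.
rewrite -(@ler_pXn2r _ 2) ?nnegrE ?mulr_ge0 ?rnorm_ge0 ?sqrtr_ge0 //.
rewrite exprMn sqr_sqrtr // bopDE bopNE bopZE bop1E rnormBZ Re_dotC.
have Xx : rnorm (X x) ^+ 2 <= m ^+ 2 * rnorm x ^+ 2.
  rewrite -exprMn ler_pXn2r ?nnegrE ?mulr_ge0 ?rnorm_ge0 ?(ltW m0) //.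
  apply: le_trans (bop_realP _ _) _; apply: ler_wpM2r => //; exact: rnorm_ge0.
have h1 := ler_wpM2l (ltW t0) (Xc x).
have h2 := ler_wpM2l (sqr_ge0 t) Xx.
have h3 : t ^+ 2 * (m ^+ 2 * rnorm x ^+ 2) = t * c * rnorm x ^+ 2.
  by rewrite -[in RHS]tm; ring.
rewrite h3 in h2; lra.
Qed.

(** A fixed point of [Z |-> t + (1 - t X) Z] is a right inverse, and the mirrored map gives a left
    inverse [Z]. Every right inverse then equals [Z], so [Z] lies in each algebra where one can be
    found. *)
Lemma accretive_inverse X (c : R) : 0 < c ->
  (forall x, c * rnorm x ^+ 2 <= Re '[X x, x]) ->
  exists Y, [/\ Y * X = 1, X * Y = 1 &
    forall M, closed_unital_algebra M -> M X -> M Y].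
Proof.
move=> c0 Xc; have [t [q [t0 q01 hq]]] := accretive_contraction c0 Xc.
have tn : t%:C != 0 :> R[i] by rewrite gt_eqF // -[0]/(0%:C) ltcR.
have /andP[q0 _] := q01.
have right_inv M : closed_unital_algebra M -> M X -> exists2 Y, M Y & X * Y = 1.
  move=> [M1 Mlin Mmul Mcl] MX.
  have MB : M (1 - t%:C *: X) by rewrite addrC -scaleNr; exact: Mlin.
  have [||Z MZ /eqP ZE] :=
      @contraction_fixpoint M (fun Z => t%:C *: 1 + (1 - t%:C *: X) * Z) 1 q q01 Mcl M1.
  - by move=> Z MZ; apply: (Mlin) => //; exact: (Mmul).
  - move=> Y Z _ _; rewrite opprD addrACA subrr add0r -mulrBr; apply: le_trans (op_normM _ _) _.
    by apply: ler_wpM2r; rewrite ?op_norm_ge0.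
  exists Z => //; apply: (scalerI tn); move: ZE.
  rewrite mulrBl mul1r addrCA -subr_eq0 addrAC subrr add0r scalerAl.
  by rewrite subr_eq0 => /eqP <-.
have [Z _ ZE] : exists2 Z, setT Z & Z * X = 1.
  have [//|//|//||Z _ /eqP ZE] :=
      @contraction_fixpoint setT (fun Z => t%:C *: 1 + Z * (1 - t%:C *: X)) 1 q q01.
    move=> Y Z _ _; rewrite opprD addrACA subrr add0r -mulrBl; apply: le_trans (op_normM _ _) _.
    by rewrite mulrC; apply: ler_wpM2r; rewrite ?op_norm_ge0.
  exists Z => //; apply: (scalerI tn); move: ZE.
  rewrite mulrBr mulr1 addrCA -subr_eq0 addrAC subrr add0r -scalerAr.
  by rewrite subr_eq0 => /eqP <-.
have ZY Y : X * Y = 1 -> Y = Z by move=> XY; rewrite -[Z]mulr1 -XY mulrA ZE mul1r.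
exists Z; split=> //; last first.
  by move=> M cM MX; have [Y MY /ZY <-] := right_inv M cM MX.
have [||Y _ XY] := right_inv setT; [by split | by [] |].
by rewrite -(ZY _ XY).
Qed.

Lemma Re_dot_le x y : Re '[x, y] <= rnorm x * rnorm y.
Proof.
rewrite -lecR realCM !rnormE; apply: le_trans (cauchy_schwarz x y).
case: '[x, y] => u v; rewrite normc_def lecR /=.
apply: le_trans (ler_norm _) _; rewrite -sqrtr_sqr ler_wsqrtr // lerDl.
exact: sqr_ge0.
Qed.

Lemma positive_of_Re T : adj T = T -> (forall x, 0 <= Re '[T x, x]) -> positive T.
Proof.
move=> aT h x; have : conjc '[T x, x] = '[T x, x] by rewrite -dotC adjPr aT.
have := h x; case: '[T x, x] => u v /= u0 [] vE.
have -> : v = 0 by lra.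
by rewrite -[_ +i* _]/(u%:C) ler0c.
Qed.

(* [1 - Z] is a square root of [1 - B] when [Z] is a fixed point of
   [Z |-> (B + Z^2) / 2], which is a contraction on small balls. *)
Lemma accretive_sqrt X (c : R) : 0 < c -> adj X = X ->
  (forall x, c * rnorm x ^+ 2 <= Re '[X x, x]) ->
  exists D, [/\ positive D, D * D = X &
    forall M, closed_unital_algebra M -> M X -> M D].
Proof.
move=> c0 aX Xc; have [t [q [t0 q01 hq]]] := accretive_contraction c0 Xc.
have /andP[q0 q1] := q01.
set B := 1 - t%:C *: X in hq.
pose F Z := (2^-1 : R)%:C *: (B + Z * Z).
have Fball Z : op_norm Z <= q -> op_norm (F Z) <= q.
  move=> hZ; rewrite op_normZC ger0_norm ?invr_ge0 // mulrC ler_pdivrMr //.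
  apply: le_trans (op_normD_le _ _) _; have := op_normM Z Z.
  have := op_norm_ge0 Z; nra.
have Flip Y Z : op_norm Y <= q -> op_norm Z <= q ->
    op_norm (F Y - F Z) <= q * op_norm (Y - Z).
  move=> hY hZ; have -> : F Y - F Z = (2^-1 : R)%:C *: (Y * (Y - Z) + (Y - Z) * Z).
    by rewrite /F -scalerBr opprD addrACA subrr add0r mulrBr mulrBl subrKA.
  rewrite op_normZC ger0_norm ?invr_ge0 // mulrC ler_pdivrMr //.
  apply: le_trans (op_normD_le _ _) _.
  have := op_normM Y (Y - Z); have := op_normM (Y - Z) Z.
  have := op_norm_ge0 (Y - Z); nra.
(* Uniqueness in the ball yields [adj Z = Z] and identifies one [Z] with the fixed points found
   inside the various [M]. *)
have fixE Y Z : op_norm Y <= q -> op_norm Z <= q -> F Y = Y -> F Z = Z -> Y = Z.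
  move=> hY hZ FY FZ; apply/subr0_eq/op_norm_le0.
  have := Flip _ _ hY hZ; rewrite FY FZ; have := op_norm_ge0 (Y - Z); nra.
have ball_closed : limit_closed [set Z | op_norm Z <= q].
  move=> T hT /=; apply/ler_addgt0Pr => e e0; have [S [/= Sq ST]] := hT _ e0.
  have := op_normB_le T S 0; rewrite !subr0 -(op_normN (T - S)) opprB; lra.
have op_norm0 : op_norm (0 : 'B(H)) <= q by rewrite -[op_norm _]/(rnorm (0 : 'B(H))) rnorm0.
have fixp M : closed_unital_algebra M -> M X ->
    exists Z, [/\ M Z, op_norm Z <= q & F Z = Z].
  move=> [M1 Mlin Mmul Mcl] MX.
  have M0 : M 0 by have := Mlin (-1) 1 1 M1 M1; rewrite scaleN1r addNr.
  have MB : M B by rewrite /B addrC -scaleNr; exact: Mlin.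
  (* [F] is known to contract only on the ball, so [M] is cut down to it. *)
  have [||||Z [MZ Zq] FZ] := @contraction_fixpoint (M `&` [set Z | op_norm Z <= q]) F 0 q q01.
  - move=> T hT; split; first by apply: Mcl => e /hT[S [[]]]; exists S.
    by apply: ball_closed => e /hT[S [[]]]; exists S.
  - by [].
  - move=> Z [MZ Zq]; split; last exact: Fball.
    rewrite /F -[_ *: _]addr0; apply: (Mlin) => //.
    by rewrite -[B]scale1r; apply: (Mlin) => //; exact: (Mmul).
  - by move=> Y Z [_ Yq] [_ Zq]; exact: Flip.
  by exists Z.
have [|//|Z [_ Zq FZ]] := fixp setT; first by split.
have aB : adj B = B.
  by rewrite /B adjB adj_one adjZ aX /conjc /= oppr0.
have aZ : adj Z = Z.
  apply: fixE; rewrite ?op_norm_adj //.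
  by rewrite -[in RHS]FZ /F adjZ adjD adjM aB /conjc /= oppr0.
have SS : (1 - Z) * (1 - Z) = t%:C *: X.
  have : (2 : R)%:C *: F Z = B + Z * Z.
    by rewrite scalerA -rmorphM mulfV // scale1r.
  rewrite FZ.
  have -> : (2 : R)%:C *: Z = Z + Z by rewrite rmorphD /= scalerDl scale1r.
  move=> h.
  have BE : B = Z + Z - Z * Z by rewrite h addrK.
  have -> : t%:C *: X = 1 - B by rewrite /B subKr.
  by rewrite BE mulrBl mul1r mulrBr mulr1 -addrA -opprD addrA.
(* [1 - Z] is a root of [t *: X], so it is rescaled. *)
set s := (Num.sqrt t)^-1.
exists (s%:C *: (1 - Z)); split.
- apply: positive_of_Re => [|x].
    by rewrite adjZ adjB adj_one aZ /conjc /= oppr0.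
  rewrite bopZE dotZl Re_realM mulr_ge0 ?invr_ge0 ?sqrtr_ge0 //.
  rewrite bopDE bopNE bop1E dotBl raddfB /= -rnorm2E subr_ge0.
  apply: le_trans (Re_dot_le _ _) _; rewrite expr2; apply: ler_wpM2r.
    exact: rnorm_ge0.
  apply: le_trans (bop_realP _ _) _; rewrite ler_piMl ?rnorm_ge0 //.
  by apply: le_trans Zq (ltW q1).
- rewrite -scalerAl -scalerAr SS !scalerA -!rmorphM /=.
  have -> : s * s * t = 1.
    rewrite /s -invfM -expr2 sqr_sqrtr ?(ltW t0) // mulVf //.
    by rewrite gt_eqF.
  by rewrite scale1r.
- move=> M cM MX; have [Z' [MZ' Zq' FZ']] := fixp M cM MX.
  have <- : Z' = Z by exact: fixE.
  have [M1 Mlin Mmul Mcl] := cM.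
  have M0 : M 0 by have := Mlin (-1) 1 1 M1 M1; rewrite scaleN1r addNr.
  rewrite -[_ *: _]addr0; apply: (Mlin) => //.
  by rewrite addrC -scaleN1r; exact: Mlin.
Qed.

End OperatorAlgebra.

(** * Uniqueness of the selected operators; multipliers and commutants *)

Section Uniqueness.
Context {R : realType} {H : hilbertType R}.
Local Open Scope complex_scope.
Implicit Types (x y z : H) (a : R[i]) (S T W X Y Z : 'B(H)) (M : set H) (A F G : set 'B(H)).
Local Notation Re := complex.Re.

Lemma oproj_eq M P : orthogonal_projection M P -> oproj M = P.
Proof.
move=> hP; rewrite /oproj; case: xgetP => [P' _ hP'|/(_ P)]; last by case.
apply/bopP => x; apply/subr0_eq/rnorm_le0.
have [[MPx orth] [MP'x orth']] := (hP x, hP' x).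
suff /eqP : '[P' x - P x, P' x - P x] = 0.
  by rewrite dotxx => /eqP/complexI/eqP; rewrite sqrf_eq0 => /eqP ->.
(* [M] is a bare set, so [P' x - P x] may lie outside it; orthogonality to [P' x] and to [P x]
   separately suffices. *)
have orthd y : M y -> '[P' x - P x, y] = 0.
  move=> My; have -> : P' x - P x = (x - P x) - (x - P' x).
    by rewrite opprB [RHS]addrC subrKA.
  by rewrite dotBl orth // orth' // subrr.
by rewrite dotBr !orthd // subrr.
Qed.

(** [T * X] and [T * Y] are self-adjoint and absorb each other, so they coincide; likewise [X * T]
    and [Y * T]. Then [Y = Y T Y = X T X = X]. *)
Lemma mp_inv_eq T X : moore_penrose T X -> mp_inv T = X.
Proof.
move=> hX; rewrite /mp_inv; case: xgetP => [Y _|/(_ X)]; last by case.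
case: hX => TXT XTX aTX aXT [TYT YTY aTY aYT].
have TE : T * Y = T * X.
  by rewrite -[in LHS]TXT -mulrA -{1}aTX -{1}aTY -adjM mulrA TYT aTX.
have ET : Y * T = X * T.
  by rewrite -[in LHS]TXT -mulrA mulrA -{1}aYT -{1}aXT -adjM -mulrA (mulrA T) TYT aXT.
by rewrite -YTY ET -mulrA TE mulrA.
Qed.

(** Positivity at [x - t *: y] reads [2 * t * r ^+ 2 <= t ^+ 2 * d], where [d <= N * r ^+ 2]. Since
    [t * N <= 1], this leaves [t * r ^+ 2 <= 0]. *)
Lemma positive_null T x : positive T -> '[T x, x] = 0 -> T x = 0.
Proof.
move=> Tp Tx0; apply: rnorm_le0; have aT := positive_adj Tp.
set y := T x; set N := op_norm T.
have N0 : 0 <= N by exact: op_norm_ge0.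
pose t := (N + 1)^-1.
have t0 : 0 < t by rewrite invr_gt0; lra.
have tN : t * N <= 1 by rewrite mulrC ler_pdivrMr; lra.
have h : 0 <= Re '[T (x - t%:C *: y), x - t%:C *: y].
  by have := Tp (x - t%:C *: y); case: '[_, _] => u v; rewrite lecE => /andP[].
have aC : conjc t%:C = t%:C :> R[i] by rewrite /conjc /= oppr0.
have TE : T (x - t%:C *: y) = y - t%:C *: T y by rewrite raddfB /= linearZ.
move: h; rewrite TE !dotBl !dotBr !dotZl !dotZr aC -[y in '[y, x]]/(T x) Tx0.
rewrite (adjP T y x) aT -/y !raddfB /= !Re_realM -!rnorm2E.
have := Re_dot_le (T y) y.
have := ler_wpM2r (rnorm_ge0 y) (bop_realP T y); rewrite -/N.
have := rnorm_ge0 y; set r := rnorm y; set d := Re _ => r0 h1 h2 h3.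
have {}h1 : d <= N * r ^+ 2 by rewrite expr2 mulrA; lra.
have h4 : t * d <= r ^+ 2.
  apply: le_trans (ler_wpM2l (ltW t0) h1) _.
  by rewrite mulrA ler_piMl ?sqr_ge0.
have h5 : t * (t * d) <= t * r ^+ 2 by apply: ler_wpM2l => //; exact: ltW.
have h6 : t * r ^+ 2 <= 0 by lra.
have : r ^+ 2 <= 0 by rewrite -(pmulr_rle0 _ t0).
by rewrite real_exprn_even_le0 ?num_real // => /eqP ->.
Qed.

(** Since [S] and [W] commute, [S + W] annihilates [d = (S - W) x]. By positivity [S d] and [W d]
    both vanish, whence ['[d, d] = '[(S - W) x, d] = 0]. *)
Lemma op_sqrt_eq T W : positive W -> W * W = T ->
  (forall S, positive S -> S * S = T -> S * W = W * S) -> op_sqrt T = W.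
Proof.
move=> Wp WW comm; rewrite /op_sqrt; case: xgetP => [S _ [Sp SS]|/(_ W)]; last by case.
have SW := comm S Sp SS.
apply/bopP => x; apply/subr0_eq/rnorm_le0.
set d := S x - W x; have dE : d = (S - W) x by [].
have sum0 : S d + W d = 0.
  rewrite dE -!bopME -bopDE -mulrDl mulrBr !mulrDl SS WW SW.
  by rewrite [W * S + T]addrC subrr.
have [Sd Wd] : '[S d, d] = 0 /\ '[W d, d] = 0.
  have : '[S d, d] + '[W d, d] = 0 by rewrite -dotDl sum0 dot0l.
  by move/eqP; rewrite paddr_eq0 ?Sp ?Wp // => /andP[/eqP -> /eqP ->].
have dd : '[d, d] = 0.
  rewrite {1}dE bopDE bopNE dotBl !adjP (positive_adj Sp) (positive_adj Wp).
  by rewrite (positive_null Sp Sd) (positive_null Wp Wd) !dot0r subrr.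
by move/eqP: dd; rewrite dotxx => /eqP/complexI/eqP; rewrite sqrf_eq0 => /eqP ->.
Qed.

(** Makes the results on unital algebras available for [A], which need not contain [1]. *)
Lemma left_multipliers A : cstar_subalgebra A ->
  closed_unital_algebra [set X | forall S, A S -> A (X * S)].
Proof.
move=> [A0 Alin Amul _ Acl]; split => /=.
- by move=> S AS; rewrite mul1r.
- by move=> a X Y AX AY S AS; rewrite mulrDl -scalerAl; apply: Alin; auto.
- by move=> X Y AX AY S AS; rewrite -mulrA; auto.
move=> X hX S AS; apply: (closed_approx Acl) => e e0.
(* The added 1 keeps the divisor positive when [S = 0]. *)
have n0 : 0 < op_norm S + 1 by have := op_norm_ge0 S; lra.
have [Y [AY YX]] := hX (e / (op_norm S + 1)) (divr_gt0 e0 n0).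
exists (Y * S); split; first exact: AY.
rewrite -mulrBl; apply: le_trans (op_normM _ _) _.
apply: le_trans (ler_wpM2r (op_norm_ge0 S) YX) _.
rewrite mulrAC ler_pdivrMr // ler_wpM2l ?(ltW e0) //; lra.
Qed.

(** An operator lying in every closed unital algebra that contains [X] therefore commutes with
    whatever [X] commutes with. *)
Lemma commutant W : closed_unital_algebra [set X | X * W = W * X].
Proof.
split => /=; first by rewrite mul1r mulr1.
- by move=> a X Y XW YW; rewrite mulrDl mulrDr -scalerAl -scalerAr XW YW.
- by move=> X Y XW YW; rewrite mulrA -XW -!mulrA YW.
move=> X hX; apply/subr0_eq/op_norm_le0/ler_addgt0Pr => e e0; rewrite add0r.
have n0 : 0 < 2 * op_norm W + 1 by have := op_norm_ge0 W; lra.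
have [Y [/= YW YX]] := hX (e / (2 * op_norm W + 1)) (divr_gt0 e0 n0).
have -> : X * W - W * X = W * (Y - X) - (Y - X) * W.
  by rewrite mulrBr mulrBl YW opprB [RHS]addrC subrKA.
apply: le_trans (op_normD_le _ _) _; rewrite op_normN.
have := op_normM W (Y - X); have := op_normM (Y - X) W.
have := ler_wpM2r (op_norm_ge0 W) YX.
have : e / (2 * op_norm W + 1) * op_norm W * 2 <= e.
  rewrite -mulrA mulrAC ler_pdivrMr // ler_wpM2l ?(ltW e0) //; lra.
set k := e / _; lra.
Qed.

Lemma cstar_gen_subalgebra F : cstar_subalgebra (cstar_gen F).
Proof.
split.
- by move=> A [[]].
- by move=> a S T hS hT A [cA FA]; case: (cA) => _ + _ _ _; apply; [apply: hS | apply: hT].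
- by move=> S T hS hT A [cA FA]; case: (cA) => _ _ + _ _; apply; [apply: hS | apply: hT].
- by move=> T hT A [cA FA]; case: (cA) => _ _ _ + _; apply; apply: hT.
rewrite /cstar_gen /smallest; apply: closed_bigI => A [[]] //.
Qed.

Lemma cstar_gen_sub F G : F `<=` cstar_gen G -> cstar_gen F `<=` cstar_gen G.
Proof.
move=> FG; apply: smallest_sub => //; exact: cstar_gen_subalgebra.
Qed.

End Uniqueness.

(** * Words in [q], [s] and [j], standing for [Q], its adjoint and [J] *)

Section RingIdentities.
Variables (A : nzRingType) (q s j l : A).
Hypotheses (qq : q * q = q) (ss : s * s = s).
Hypotheses (jq : j * q = q * j) (js : j * s = s * j).
Hypotheses (qsq : q * s * q * (j * j) = q) (sqs : s * q * s * (j * j) = s).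

Local Notation p := (q * s * j * j).
Local Notation w := (q * s * j).
Local Notation d := (q * s * j * j * j).

(** These rules, gathered in [nf], move [j] to the right and shorten [q q], [s s], [q s q j j] and
    [s q s j j]. The forms with a tail [x] apply inside right-associated words. *)
Let qqK x : q * (q * x) = q * x. Proof. by rewrite mulrA qq. Qed.
Let ssK x : s * (s * x) = s * x. Proof. by rewrite mulrA ss. Qed.
Let jqK x : j * (q * x) = q * (j * x). Proof. by rewrite !mulrA jq. Qed.
Let jsK x : j * (s * x) = s * (j * x). Proof. by rewrite !mulrA js. Qed.
Let qsqE : q * (s * (q * (j * j))) = q. Proof. by rewrite -[RHS]qsq !mulrA. Qed.
Let sqsE : s * (q * (s * (j * j))) = s. Proof. by rewrite -[RHS]sqs !mulrA. Qed.
Let qsqK x : q * (s * (q * (j * (j * x)))) = q * x.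
Proof. by rewrite -[in RHS]qsq !mulrA. Qed.
Let sqsK x : s * (q * (s * (j * (j * x)))) = s * x.
Proof. by rewrite -[in RHS]sqs !mulrA. Qed.
Let nf := (qqK, ssK, jqK, jsK, qq, ss, jq, js, qsqE, sqsE, qsqK, sqsK).

Lemma abs_sqr : w * w = q * s. Proof. by rewrite -!mulrA !nf. Qed.
Lemma abs_pinv : w * d = p. Proof. by rewrite -!mulrA !nf. Qed.
Lemma pinv_abs : d * w = p. Proof. by rewrite -!mulrA !nf. Qed.
Lemma proj_q : p * q = q. Proof. by rewrite -!mulrA !nf. Qed.
Lemma q_proj : q * p = p. Proof. by rewrite -!mulrA !nf. Qed.
Lemma proj_s : p * s = p. Proof. by rewrite -!mulrA !nf. Qed.
Lemma s_proj : s * p = s. Proof. by rewrite -!mulrA !nf. Qed.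
Lemma proj_idem : p * p = p. Proof. by rewrite -!mulrA !nf. Qed.
Lemma proj_abs : p * w = w. Proof. by rewrite -!mulrA !nf. Qed.
Lemma abs_proj : w * p = w. Proof. by rewrite -!mulrA !nf. Qed.
Lemma proj_pinv : p * d = d. Proof. by rewrite -!mulrA !nf. Qed.
Lemma pinv_proj : d * p = d. Proof. by rewrite -!mulrA !nf. Qed.
Lemma q_abs : q * w = w. Proof. by rewrite -!mulrA !nf. Qed.
Lemma abs_s : w * s = w. Proof. by rewrite -!mulrA !nf. Qed.
Lemma s_pinv2_q : s * d * (d * q) = s * q * j * j.
Proof. by rewrite -!mulrA !nf. Qed.

End RingIdentities.

(** * The symmetry [u], where [y] stands for twice the matched projection *)

Section SymmetryIdentities.
Variables (A : nzRingType) (p q s w d l : A).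
Hypotheses (pq : p * q = q) (qp : q * p = p) (ps : p * s = p) (sp : s * p = s).
Hypotheses (pp : p * p = p) (pw : p * w = w) (wp : w * p = w).
Hypotheses (pd : p * d = d) (dp : d * p = d) (wd : w * d = p) (dw : d * w = p).
Hypotheses (qw : q * w = w) (ws : w * s = w) (ww : w * w = q * s).
Hypotheses (lw : l * (w + 1) = 1) (wl : (w + 1) * l = 1).

Let dl : d * l = l * d.
Proof.
have dw1 : d * (w + 1) = (w + 1) * d by rewrite mulrDl mulrDr dw wd mul1r mulr1.
by rewrite -[LHS]mul1r -lw -mulrA (mulrA (w + 1)) -dw1 -mulrA wl mulr1.
Qed.

(** In the corner cut out by [p], where [d] inverts [w], this is the inverse of [w * (w + 1)]. *)
Let k := d * l.
Let kw : k * (w + 1) = d. Proof. by rewrite /k -mulrA lw mulr1. Qed.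
Let wk : (w + 1) * k = d. Proof. by rewrite /k dl mulrA wl mul1r. Qed.
Let kp : k * p = k. Proof. by rewrite /k dl -mulrA dp. Qed.
Let pk : p * k = k. Proof. by rewrite /k mulrA pd. Qed.
Let wpk : (w + p) * k = d. Proof. by rewrite mulrDl pk -wk mulrDl mul1r. Qed.
Let kwp : k * (w + p) = d. Proof. by rewrite mulrDr kp -kw mulrDr mulr1. Qed.

Let y := (w + s) * d * l * (w + q).
Let yE : y = (w + s) * (k * (w + q)). Proof. by rewrite /y /k !mulrA. Qed.

Let py : p * y = p + d * q.
Proof. by rewrite yE mulrA mulrDr pw ps mulrA wpk mulrDr dw. Qed.

Let yp : y * p = p + s * d.
Proof.
have bp : (w + q) * p = w + p by rewrite mulrDl wp qp.
by rewrite yE -mulrA -(mulrA k) bp kwp mulrDl wd.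
Qed.

(** The inner product [(w + q) * (w + s)] is twice [(w + 1) * w], so the middle factor between the
    two copies of [k] collapses and leaves [k + k]. *)
Let yy : y * y = y + y.
Proof.
have kk : k * ((w + q) * (w + s)) * k = k + k.
  have -> : (w + q) * (w + s) = (w + 1) * w + (w + 1) * w.
    by rewrite mulrDl !mulrDr ws qw -ww mulrDl mul1r [w + w * w]addrC.
  by rewrite mulrDr mulrDl mulrA kw dw pk.
have -> : y * y = (w + s) * (k * ((w + q) * (w + s)) * k) * (w + q).
  by rewrite yE !mulrA.
by rewrite kk (mulrDr _ k) (mulrDl _ _ (w + q)) yE !mulrA.
Qed.

Let u := y - 1.

Lemma proj_symmetry : p * u = d * q.
Proof. by rewrite mulrBr mulr1 py addrC addKr. Qed.

Lemma symmetry_proj : u * p = s * d.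
Proof. by rewrite mulrBl mul1r yp addrC addKr. Qed.

Lemma symmetry_sqr : u * u = 1.
Proof. by rewrite mulrBr mulr1 mulrBl mul1r yy addrK opprB addrC subrK. Qed.

Lemma corner_symmetry : p * u * p = d.
Proof. by rewrite proj_symmetry -mulrA qp dp. Qed.

Lemma abs_symmetry : w * p * u = q.
Proof. by rewrite -mulrA proj_symmetry mulrA wd. Qed.

Lemma conj_symmetry : u * p * u = s * d * (d * q).
Proof. by rewrite -pp mulrA symmetry_proj -mulrA proj_symmetry. Qed.

End SymmetryIdentities.

(** * The matched projection of an idempotent and the generated algebras *)

Section MatchedProjection.
Context {R : realType} {H : hilbertType R}.
Local Open Scope complex_scope.
Implicit Types (x y z : H) (a : R[i]) (S T X Y Z : 'B(H)).
Local Notation Re := complex.Re.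

Lemma closed_unital_algebraB (M : set 'B(H)) S T :
  closed_unital_algebra M -> M S -> M T -> M (S - T).
Proof. by move=> [_ Mlin _ _] MS MT; rewrite addrC -scaleN1r; exact: Mlin. Qed.

Lemma closed_unital_algebraD (M : set 'B(H)) S T :
  closed_unital_algebra M -> M S -> M T -> M (S + T).
Proof. by move=> [_ Mlin _ _] MS MT; rewrite -[S]scale1r; exact: Mlin. Qed.

Lemma cstar_subalgebraD (B : set 'B(H)) S T :
  cstar_subalgebra B -> B S -> B T -> B (S + T).
Proof. by move=> [_ Blin _ _ _] BS BT; rewrite -[S]scale1r; exact: Blin. Qed.

Lemma cstar_subalgebraB (B : set 'B(H)) S T :
  cstar_subalgebra B -> B S -> B T -> B (S - T).
Proof. by move=> [_ Blin _ _ _] BS BT; rewrite addrC -scaleN1r; exact: Blin. Qed.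

Lemma cstar_subalgebraZ (B : set 'B(H)) a S :
  cstar_subalgebra B -> B S -> B (a *: S).
Proof. by move=> [B0 Blin _ _ _] BS; rewrite -[_ *: _]addr0; exact: Blin. Qed.

Lemma adj_mul_Re T x : Re '[(adj T * T) x, x] = rnorm (T x) ^+ 2.
Proof. by rewrite bopME adjP adjK dotxx. Qed.

Lemma accretive_invsqrt X (c : R) : 0 < c -> adj X = X ->
  (forall x, c * rnorm x ^+ 2 <= Re '[X x, x]) ->
  exists J, [/\ positive J, J * J * X = 1 &
    forall M, closed_unital_algebra M -> M X -> M J].
Proof.
move=> c0 aX Xc; have [D [Dp DD DM]] := accretive_sqrt c0 aX Xc.
have [Y [YX XY YM]] := accretive_inverse c0 Xc.
have XD : X * D = D * X by rewrite -DD mulrA.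
have YD : Y * D = D * Y by exact: (YM _ (commutant D) XD).
have DDY : D * (D * Y) = 1 by rewrite mulrA DD.
exists (D * Y); split.
(* Writing the second [x] as [D (D (Y x))] and moving one [D] across gives the form of [D] at
   [D (Y x)]. *)
- move=> x; rewrite -[x in '[_, x]]bop1E -DDY [in X in '[_, X]]bopME adjPr.
  by rewrite (positive_adj Dp); exact: Dp.
- by rewrite -!mulrA YX mulr1 YD.
by move=> M cM MX; case: (cM) => _ _ + _; apply; [exact: DM | exact: YM].
Qed.

(** [X] itself may be indefinite, but [X * X] is bounded below because [X] has a bounded inverse.
    Then [Y] is the inverse of [X * X] times [X]. *)
Lemma self_adjoint_inverse (M : set 'B(H)) X Y : closed_unital_algebra M ->
  M X -> adj X = X -> Y * X = 1 -> X * Y = 1 -> M Y.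
Proof.
move=> cM MX aX YX XY; have [_ _ Mmul _] := cM.
pose n := op_norm Y + 1; have n0 : 0 < n by have := op_norm_ge0 Y; rewrite /n; lra.
have n20 : 0 < n ^- 2 by rewrite invr_gt0 exprn_gt0.
have [|Z [ZX XZ MZ]] := @accretive_inverse _ _ (X * X) (n ^- 2) n20.
  move=> x; rewrite -{1}aX adj_mul_Re mulrC ler_pdivrMr ?exprn_gt0 //.
  rewrite -exprMn ler_pXn2r ?nnegrE ?mulr_ge0 ?rnorm_ge0 ?(ltW n0) //.
  rewrite -{1}[x]bop1E -YX bopME mulrC; apply: le_trans (bop_realP _ _) _.
  by apply: ler_wpM2r; rewrite ?rnorm_ge0 // /n; lra.
have -> : Y = Z * X by rewrite -[RHS]mulr1 -XY mulrA -(mulrA Z) ZX mul1r.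
by apply: (Mmul) => //; apply: MZ => //; exact: (Mmul).
Qed.

Section Idempotent.
Variables (Q : 'B(H)).
Hypothesis QQ : Q * Q = Q.
Let Qs := adj Q.
Let G := 1 + adj (Q - Qs) * (Q - Qs).

Let QsQs : Qs * Qs = Qs. Proof. by rewrite -adjM QQ. Qed.
Let GE : G = 1 + (Qs - Q) * (Q - Qs). Proof. by rewrite /G adjB adjK. Qed.

Let GQ : G * Q = Q * Qs * Q.
Proof.
rewrite GE mulrDl mul1r -mulrA (mulrBl Q) QQ mulrBl mulrBr (mulrBr Q) QQ.
by rewrite (mulrA Qs Qs) QsQs subrr sub0r opprB addrC subrK mulrA.
Qed.

Let QG : Q * G = Q * Qs * Q.
Proof.
rewrite GE mulrDr mulr1 mulrA (mulrBr Q) QQ mulrBr mulrBl (mulrBl Qs) QQ.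
by rewrite -(mulrA Q Qs Qs) QsQs subrr subr0 addrC subrK.
Qed.

Let aG : adj G = G.
Proof. by rewrite /G (adjD 1) adj_one adjM adjK. Qed.

Let QsG : Qs * G = G * Qs.
Proof. by rewrite -[LHS]adjK adjM aG adjK GQ -QG adjM aG. Qed.

Lemma idempotent_invsqrt : exists J, [/\ positive J, J * J * G = 1 &
  forall M, closed_unital_algebra M -> M G -> M J].
Proof.
apply: (accretive_invsqrt (c := 1)) => //.
move=> x; rewrite mul1r bopDE bop1E dotDl raddfD /= adj_mul_Re -rnorm2E lerDl.
exact: sqr_ge0.
Qed.


Variable J : 'B(H).
Hypotheses (Jp : positive J) (JJG : J * J * G = 1).
Hypothesis JM : forall M, closed_unital_algebra M -> M G -> M J.
(** [op_absE], [oproj_range] and [mp_invE] below identify [W], [P] and [D] with the operators of the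
    statement; [Y] is then twice the matched projection. *)
Let W := Q * Qs * J.
Let P := Q * Qs * J * J.
Let D := Q * Qs * J * J * J.
Let L : 'B(H) := (W + 1)^-1.
Let Y := (W + Qs) * D * L * (W + Q).

Let aJ : adj J = J. Proof. exact: positive_adj. Qed.
Let JQ : J * Q = Q * J. Proof. by apply: (JM (commutant Q)); rewrite /= GQ QG. Qed.
Let JQs : J * Qs = Qs * J. Proof. by apply: (JM (commutant Qs)); rewrite /= QsG. Qed.
Let GJJ : G * (J * J) = 1.
Proof. by rewrite mulrA -(JM (commutant G) erefl) -mulrA -(JM (commutant G) erefl) mulrA. Qed.
Let QsQ : Q * Qs * Q * (J * J) = Q. Proof. by rewrite -QG -mulrA GJJ mulr1. Qed.
Let QsQQs : Qs * Q * Qs * (J * J) = Qs.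
Proof.
have -> : Qs * Q * Qs = Qs * G by rewrite QsG -[RHS]adjK adjM aG adjK QG !adjM adjK mulrA.
by rewrite -mulrA GJJ mulr1.
Qed.
Let JE : J * (Q * Qs) = Q * Qs * J.
Proof. by rewrite mulrA JQ -!mulrA JQs. Qed.

Let WW : W * W = Q * Qs. Proof. by apply: (@abs_sqr _ Q Qs J). Qed.
Let WD : W * D = P. Proof. by apply: (@abs_pinv _ Q Qs J). Qed.
Let DW : D * W = P. Proof. by apply: (@pinv_abs _ Q Qs J). Qed.
Let PQ : P * Q = Q. Proof. by apply: (@proj_q _ Q Qs J). Qed.
Let QP : Q * P = P. Proof. by apply: (@q_proj _ Q Qs J). Qed.
Let PQs : P * Qs = P. Proof. by apply: (@proj_s _ Q Qs J). Qed.
Let QsP : Qs * P = Qs. Proof. by apply: (@s_proj _ Q Qs J). Qed.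
Let PP : P * P = P. Proof. by apply: (@proj_idem _ Q Qs J). Qed.
Let PW : P * W = W. Proof. by apply: (@proj_abs _ Q Qs J). Qed.
Let WP : W * P = W. Proof. by apply: (@abs_proj _ Q Qs J). Qed.
Let PD : P * D = D. Proof. by apply: (@proj_pinv _ Q Qs J). Qed.
Let DP : D * P = D. Proof. by apply: (@pinv_proj _ Q Qs J). Qed.
Let QW : Q * W = W. Proof. by apply: (@q_abs _ Q Qs J). Qed.
Let WQs : W * Qs = W. Proof. by apply: (@abs_s _ Q Qs J). Qed.
Let DDQ : Qs * D * (D * Q) = Qs * Q * J * J. Proof. by apply: (@s_pinv2_q _ Q Qs J). Qed.

Let JP : J * P = D. Proof. by rewrite /P 2!(mulrA J) JE. Qed.

Let aP : adj P = P.
Proof. by rewrite /P !adjM adjK aJ JE mulrA JE. Qed.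

Let aW : adj W = W.
Proof. by rewrite /W !adjM adjK aJ JE. Qed.

Let aD : adj D = D.
Proof. by rewrite -[D]/(P * J) adjM aJ aP JP. Qed.

(** [W] equals [Q * J * Qs], a conjugate of the positive [J]. *)
Let positiveW : positive W.
Proof. by move=> x; rewrite /W -mulrA -JQs !bopME adjP; exact: Jp. Qed.

(** A positive root [S] of [Q * Qs] vanishes where [Qs] does, so [S * P = S = P * S]. As
    [P * G = G * P = S * S], it commutes with [G], hence with [J] and with [W = S * S * J]. *)
Let op_absE : op_abs (adj Q) = W.
Proof.
rewrite /op_abs adjK; apply: op_sqrt_eq => // S Sp SS.
have aS := positive_adj Sp.
have SP : S * P = S.
  apply/eqP; rewrite eq_sym -subr_eq0; apply/eqP/bopP => x; apply: rnorm_le0.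
  set y := x - P x.
  have -> : (S - S * P) x = S y by rewrite /y raddfB.
  have : rnorm (S y) ^+ 2 = 0.
    rewrite rnorm2E adjPr aS -bopME SS.
    have -> : (Q * Qs) y = 0 by rewrite bopME /y raddfB /= -[Qs (P x)]bopME QsP subrr raddf0.
    by rewrite dot0l.
  by move/eqP; rewrite sqrf_eq0 => /eqP ->.
have PS : P * S = S by rewrite -[RHS]aS -[in RHS]SP adjM aS aP.
have PG : P * G = Q * Qs by rewrite /P -!mulrA [J * _]mulrA JJG mulr1.
have GP : G * P = Q * Qs by rewrite -[LHS]adjK adjM aP aG PG adjM adjK.
have SG : S * G = G * S.
  by rewrite -[in LHS]SP -mulrA PG -[in RHS]PS (mulrA G) GP -SS mulrA.
have SJ : J * S = S * J by apply: (JM (commutant S)); rewrite /= SG.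
by rewrite /W -SS -!mulrA SJ.
Qed.

Let mp_invE : mp_inv W = D.
Proof. by apply: mp_inv_eq; split; rewrite ?WD ?DW ?PW ?PD. Qed.

Let mp_invDE : mp_inv D = W.
Proof. by apply: mp_inv_eq; split; rewrite ?WD ?DW ?PW ?PD. Qed.

Let oproj_range : oproj (op_range Q) = P.
Proof.
apply: oproj_eq => x; split; first by exists ((Qs * J * J) x).
move=> _ [z _ <-]; rewrite adjPr raddfB /= -/Qs -[Qs (P x)]bopME QsP.
by rewrite subrr dot0l.
Qed.

(** [P'] maps into the range of [Qs], which is orthogonal to the null space of [Q], and [Q * P' = Q]
    puts [x - P' x] in that null space. *)
Let oproj_null : 1 - oproj (op_null Q) = Qs * Q * J * J.
Proof.
set P' := Qs * Q * J * J.
have QP' : Q * P' = Q by rewrite /P' !mulrA -(mulrA _ J J) QsQ.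
rewrite (@oproj_eq _ _ _ (1 - P')) ?subKr // => x; split.
  rewrite -[op_null _ _]/(Q (x - P' x) = 0) raddfB /= -[Q (P' x)]bopME QP'.
  exact: subrr.
move=> y Qy; rewrite -['[_, _]]/('[x - (x - P' x), y]) subKr.
by rewrite -[P' x]/(Qs ((Q * J * J) x)) adjP adjK Qy dot0r.
Qed.

(** Invertibility has to be shown, since the ring inverse returns its argument on non-units; it
    follows from positivity of [W]. *)
Let unitW1 : L * (W + 1) = 1 /\ (W + 1) * L = 1.
Proof.
have [|Z [ZW WZ _]] := @accretive_inverse _ _ (W + 1) 1 ltr01.
  move=> x; rewrite mul1r bopDE bop1E dotDl raddfD /= -rnorm2E lerDr.
  by have := positiveW x; case: '[_, _] => u v; rewrite lecE => /andP[].
have uW : W + 1 \is a GRing.unit by apply/unitrP; exists Z.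
by split; [exact: mulVr | exact: divrr].
Qed.
Let LW := unitW1.1.
Let WL := unitW1.2.

Let matchedE : 2 * matched_projection Q - 1 = Y - 1.
Proof.
congr (_ - 1); rewrite /matched_projection op_absE mp_invE mulr_natl scalerMnl.
by rewrite -mulr_natr mulVf ?pnatr_eq0 // scale1r.
Qed.


Let m := matched_projection Q.
Let U := 2 * m - 1.

Let symmetry (E : 'B(H) -> Prop) : E (Y - 1) -> E U.
Proof. by rewrite /U /m matchedE. Qed.

Let UU : U * U = 1.
Proof. by apply: (symmetry (E := fun V => V * V = 1)); apply: (@symmetry_sqr _ P Q Qs W D L). Qed.

Let PUP : P * U * P = D.
Proof. by apply: (symmetry (E := fun V => P * V * P = D)); apply: (@corner_symmetry _ P Q Qs W D L). Qed.

Let WPU : W * P * U = Q.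
Proof. by apply: (symmetry (E := fun V => W * P * V = Q)); apply: (@abs_symmetry _ P Q Qs W D L). Qed.

Let UPU : U * P * U = Qs * Q * J * J.
Proof.
apply: (symmetry (E := fun V => V * P * V = Qs * Q * J * J)).
by rewrite -DDQ; apply: (@conj_symmetry _ P Q Qs W D L).
Qed.

Let adj_gen (F : set 'B(H)) T : cstar_gen F T -> cstar_gen F (adj T).
Proof. by have [_ _ _ + _] := cstar_gen_subalgebra F; apply. Qed.

Let mul_gen (F : set 'B(H)) S T : cstar_gen F S -> cstar_gen F T -> cstar_gen F (S * T).
Proof. by have [_ _ + _ _] := cstar_gen_subalgebra F; apply. Qed.

(** [U] may lie outside the algebra for lack of [1], but [U * T = 2 * m * T - T] stays inside. *)
Let gen_sym (F : set 'B(H)) T : cstar_gen F m -> cstar_gen F T ->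
  cstar_gen F (U * T).
Proof.
move=> Fm FT; have cF := cstar_gen_subalgebra F.
rewrite mulrBl mul1r; apply: (cstar_subalgebraB cF) => //; apply: mul_gen => //.
by rewrite mulr_natl mulr2n; exact: (cstar_subalgebraD cF).
Qed.

Let gen_symr (F : set 'B(H)) T : cstar_gen F m -> cstar_gen F T ->
  cstar_gen F (T * U).
Proof.
move=> Fm FT; have cF := cstar_gen_subalgebra F.
rewrite mulrBr mulr1; apply: (cstar_subalgebraB cF) => //; apply: mul_gen => //.
by rewrite mulr_natl mulr2n; exact: (cstar_subalgebraD cF).
Qed.

Let gen_conj (F : set 'B(H)) T : cstar_gen F m -> cstar_gen F T ->
  cstar_gen F (U * T * U).
Proof. by move=> Fm FT; apply: gen_symr => //; exact: gen_sym. Qed.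

Let idempotent_sub_gen : cstar_gen [set Q] `<=` cstar_gen [set m; P].
Proof.
set F := [set m; P]; have cF := cstar_gen_subalgebra F.
apply: cstar_gen_sub => _ ->.
have Fm : cstar_gen F m by apply: sub_gen_smallest; left.
have FP : cstar_gen F P by apply: sub_gen_smallest; right.
have FD : cstar_gen F D by rewrite -PUP; apply: mul_gen => //; exact: gen_symr.
have cM := left_multipliers cF; have [M1 _ _ _] := cM.
have [C CE] : exists C, C = 1 - P by exists (1 - P).
have CP0 T : P * T = T -> C * T = 0 by move=> PT; rewrite CE mulrBl mul1r PT subrr.
have PC0 T : T * P = T -> T * C = 0 by move=> TP; rewrite CE mulrBr mulr1 TP subrr.
have CC : C * C = C by rewrite {1}CE mulrBl mul1r (PC0 P PP) subr0.
have PC1 : P + C = 1 by rewrite CE subrKC.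
(* [D] and [W] are inverse only relative to [P]; adding [C] makes them true inverses, and [W] is
   recovered as [V * P]. *)
pose X := D + C; pose V := W + C.
have [XV VX] : X * V = 1 /\ V * X = 1.
  rewrite /X /V (mulrDl D) (mulrDl W) !mulrDr CC DW WD.
  by rewrite (CP0 _ PD) (CP0 _ PW) (PC0 _ DP) (PC0 _ WP) addr0 add0r.
have MV : [set X | forall S, cstar_gen F S -> cstar_gen F (X * S)] V.
  apply: (self_adjoint_inverse cM (X := X)) => //.
    apply: (closed_unital_algebraD cM) => //; first by move=> S; exact: mul_gen.
    by rewrite CE; apply: (closed_unital_algebraB cM) => // S; exact: mul_gen.
  by rewrite /X adjD CE adjB adj_one aP aD.
have FW : cstar_gen F W.
  have -> : W = V * P by rewrite mulrDl (CP0 _ PP) addr0 WP.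
  exact: MV.
by rewrite -WPU; apply: gen_symr => //; exact: mul_gen.
Qed.

Let gen_sub_idempotent : cstar_gen [set m; P] `<=` cstar_gen [set Q].
Proof.
set F := [set Q]; have cF := cstar_gen_subalgebra F.
have FQ : cstar_gen F Q by exact: sub_gen_smallest.
have FQs : cstar_gen F Qs by exact: adj_gen.
have FQQs : cstar_gen F (Q * Qs) by exact: mul_gen.
have cM := left_multipliers cF; have [M1 _ _ _] := cM.
have MJ : [set X | forall S, cstar_gen F S -> cstar_gen F (X * S)] J.
  (* [1] is a multiplier, and the other summand of [G] lies in the algebra. *)
  apply: (JM cM); apply: (closed_unital_algebraD cM) => // S.
  by apply: mul_gen; apply: mul_gen; rewrite ?adjB; apply: (cstar_subalgebraB cF) => //; apply: adj_gen.
have FW : cstar_gen F W by rewrite /W -JE; exact: MJ.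
have FP : cstar_gen F P by rewrite /P -JE -mulrA -/W; apply: MJ.
have FD : cstar_gen F D.
  by rewrite -JP; exact: MJ.
have ML : [set X | forall S, cstar_gen F S -> cstar_gen F (X * S)] L.
  apply: (self_adjoint_inverse cM (X := W + 1)) => //.
    by apply: (closed_unital_algebraD cM) => // S; exact: mul_gen.
  by rewrite adjD adj_one aW.
apply: cstar_gen_sub => _ [->|->] //.
rewrite /m /matched_projection op_absE mp_invE. apply: (cstar_subalgebraZ _ cF).
(* [L] is only known to be a multiplier, so it is grouped with [W + Q], on which it acts from the
   left. *)
rewrite -mulrA; apply: mul_gen; last by apply: ML; exact: (cstar_subalgebraD cF).
by apply: mul_gen => //; exact: (cstar_subalgebraD cF).
Qed.

Lemma idempotent_matched_projection :
  let PR := oproj (op_range Q) in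
  let PN := oproj (op_null Q) in
  let mQ := matched_projection Q in
  Q = mp_inv (PR * (2 * mQ - 1) * PR) * PR * (2 * mQ - 1)
  /\ cstar_gen [set Q] = cstar_gen [set mQ; PR]
  /\ cstar_gen [set mQ; PR] = cstar_gen [set mQ; 1 - PN].
Proof.
move=> PR PN mQ; rewrite /PR oproj_range /PN oproj_null /mQ -/m -/U.
(* The corner [P * U * P] is [D], whose Moore-Penrose inverse is [W]; what remains is
   [W * P * U = Q]. *)
split; first by rewrite PUP mp_invDE WPU.
split; apply/seteqP; split.
- exact: idempotent_sub_gen.
- exact: gen_sub_idempotent.
- apply: cstar_gen_sub => _ [->|->]; first by apply: sub_gen_smallest; left.
  (* Since [U * U = 1], conjugation by [U] exchanges the two projections. *)
  have -> : P = U * (Qs * Q * J * J) * U.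
    by rewrite -UPU !mulrA UU mul1r -mulrA UU mulr1.
  by apply: gen_conj; apply: sub_gen_smallest; [left | right].
- apply: cstar_gen_sub => _ [->|->]; first by apply: sub_gen_smallest; left.
  by rewrite -UPU; apply: gen_conj; apply: sub_gen_smallest; [left | right].
Qed.

End Idempotent.
End MatchedProjection.

Theorem theorem3p3 (R : realType) (H : hilbertType R) (Q : 'B(H)) :
  Q * Q = Q ->
  let PR := oproj (op_range Q) in
  let PN := oproj (op_null Q) in
  let mQ := matched_projection Q in
  Q = mp_inv (PR * (2 * mQ - 1) * PR) * PR * (2 * mQ - 1)
  /\ cstar_gen [set Q] = cstar_gen [set mQ; PR]
  /\ cstar_gen [set mQ; PR] = cstar_gen [set mQ; 1 - PN].
Proof.
move=> QQ; have [J [Jp JJG JM]] := idempotent_invsqrt Q.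
exact: (idempotent_matched_projection QQ Jp JJG JM).
Qed.
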